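(* Let $\mathcal{K} = \mathcal{K}^1 \cap \mathcal{K}^2$, where $\mathcal{K}^1,\mathcal{K}^2\subseteq\mathbb{R}^n$ are closed convex cones. (i) Let $\mathcal{F}_{\min}^{D_{\text{dup}}} = \mathcal{F}^1 \times \mathcal{F}^2$ be the minimal face of $\mathcal{K}^1 \times \mathcal{K}^2$ containing the set of feasible slacks of $(D_{\text{dup}})$. Then $\mathcal{F}_{\min}^D = \mathcal{F}^1 \cap \mathcal{F}^2$. (ii) The singularity degree and the distance to strong duality of (D) satisfy $$d(D) \leq d(D_{\text{dup}}) \leq 1+ \ell_{\text{poly}}(\mathcal{K}^1) + \ell_{\text{poly}}(\mathcal{K}^2),$$ $$d_{\text{str}}(D) \leq d_{\text{str}}(D_{\text{dup}}) \leq \ell_{\text{poly}}(\mathcal{K}^1) + \ell_{\text{poly}}(\mathcal{K}^2).$$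
   Context: Let $\mathcal{A}:\mathbb{R}^n\to\mathbb{R}^m$ be linear with adjoint $\mathcal{A}^*$, $b\in\mathbb{R}^m$, $c\in\mathbb{R}^n$. A star on a cone denotes the dual cone, and $\perp$ the orthogonal complement. General dual-form problems. Given a closed convex cone $\mathcal{C}$ in a Euclidean space $E$, a linear map $\mathcal{B}:E\to\mathbb{R}^m$, and $g\in E$, consider $(\mathrm{Q})$: $\sup\{\langle b,y\rangle : g-\mathcal{B}^*y\in\mathcal{C}\}$, with optimal value $\theta_Q$ ($-\infty$ if infeasible). Its feasible slacks are the points $g-\mathcal{B}^*y\in\mathcal{C}$, and its minimal face is the minimal face of $\mathcal{C}$ containing all feasible slacks (empty if infeasible). Problem (D) is the case $E=\mathbb{R}^n$, $\mathcal{C}=\mathcal{K}=\mathcal{K}^1\cap\mathcal{K}^2$, $\mathcal{B}=\mathcal{A}$, $g=c$, with minimal face $\mathcal{F}_{\min}^D$. Problem $(D_{\text{dup}})$ is $\sup\{\langle b,y\rangle : (c-\mathcal{A}^*y,\,c-\mathcal{A}^*y)\in\mathcal{K}^1\times\mathcal{K}^2\}$, i.e. $E=\mathbb{R}^n\times\mathbb{R}^n$, $\mathcal{C}=\mathcal{K}^1\times\mathcal{K}^2$, $\mathcal{B}(x^1,x^2)=\mathcal{A}(x^1+x^2)$, $g=(c,c)$. Generic Facial Reduction for (Q): (1) Set $\mathcal{F}_1=\mathcal{C}$, $i=1$. (2) Let $d_i\in\mathcal{F}_i^*\cap\ker\mathcal{B}$ be such that either $d_i\notin\mathcal{F}_i^\perp$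 and $\langle g,d_i\rangle=0$, or $\langle g,d_i\rangle<0$; if no such $d_i$ exists, the minimal face is $\mathcal{F}_i$; stop. (3) If $\langle g,d_i\rangle<0$, the minimal face is $\emptyset$; stop. (4) If $\langle g,d_i\rangle=0$, set $\mathcal{F}_{i+1}=\mathcal{F}_i\cap\{d_i\}^\perp$, increase $i$ by one, and return to (2). The output includes the set of all directions found (including a last one with $\langle g,d_i\rangle<0$, if any). The singularity degree $d(Q)$ is the minimum number of directions among all possible outputs. Distance to strong duality (no feasibility of (Q) is assumed): $d_{\text{str}}(Q)$ is the minimum number of facial reduction steps at (Q), i.e. steps as in the Generic Facial Reduction above, needed to ensure $\theta_{\hat P}=\theta_Q$, where $(\hat{\mathrm{P}})$ is the problem $\inf\{\langle g,x\rangle : \mathcal{B}x=b,\ x\in\mathcal{F}_{\ell+1}^*\}$ with optimal value $\theta_{\hat P}$ ($+\infty$ if infeasible), and $\mathcal{F}_{\ell+1}$ is a face obtained after a sequence of $\ell$ facial reduction steps. If $-\infty<\theta_Q<+\infty$, attainment of $\theta_{\hat P}$ is also required. The distance to polyhedrality $\ell_{\text{poly}}(\mathcal{C})$ of a nonempty closed convex cone $\mathcal{C}$ is the length minus one of the longest strictly ascending chain of nonempty faces $\mathcal{F}_1\subsetneq\cdots\subsetneq\mathcal{F}_\ell$ of $\mathcal{C}$ (length $\ell$) such that $\mathcal{F}_1$ is polyhedral and $\mathcal{F}_j$ is not polyhedral for all $j>1$.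
   Formalization: The bound of d_str(D_dup) by the distances to polyhedrality is asserted unless (D_dup) is infeasible and the primal is infeasible at every face reached by facial reduction; there the minimum defining d_str(D_dup) does not exist (e.g. both cones {0} in R, A=0, b=c=1). *)

(* Defs.v *)
From HB Require Import structures.
From mathcomp Require Import all_boot all_order all_algebra.
From mathcomp Require Import all_classical all_reals all_analysis.
Set Implicit Arguments.
Unset Strict Implicit.
Unset Printing Implicit Defensive.
Import Order.TTheory GRing.Theory Num.Theory.
Import numFieldNormedType.Exports.
Local Open Scope classical_set_scope.
Local Open Scope ring_scope.

(* R^k is ['cV[R]_k] with the standard inner product; R^n x R^n is
   ['cV[R]_(n + n)], a pair (x, y) being the block vector [col_mx x y], so that
   its standard inner product is the product one. *)

Section Cones.
Variables (R : realType) (k : nat).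
Implicit Types (u v x y : 'cV[R]_k) (S C F : set 'cV[R]_k).

Definition dot u v : R := \sum_(i < k) u i 0 * v i 0.

(* The empty set qualifies: it is the minimal face of an infeasible problem. *)
Definition convex_cone C : Prop :=
  forall x y (s t : R), C x -> C y -> 0 <= s -> 0 <= t -> C (s *: x + t *: y).

Definition closed_convex_cone C : Prop :=
  [/\ C !=set0, closed C & convex_cone C].

(* [set0] is a face of every cone. *)
Definition face C F : Prop :=
  [/\ F `<=` C, convex_cone F &
      forall x y, C x -> C y -> F (x + y) -> F x /\ F y].

Definition polyhedral C : Prop :=
  exists (p : nat) (N : 'M[R]_(p, k)), C = [set x | forall i, 0 <= (N *m x) i 0].

Definition dual_cone S : set 'cV[R]_k := [set u | forall x, S x -> 0 <= dot u x].

Definition orth S : set 'cV[R]_k := [set u | forall x, S x -> dot u x = 0].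

(* Faces are stable under intersection, so this is the smallest face of [C]
   containing [S]; it is [set0] when [S] is, because [set0] is a face. *)
Definition min_face C S : set 'cV[R]_k :=
  \bigcap_(F in [set F | face C F /\ S `<=` F]) F.

(* Here [f ord0] is the smallest face F_1 of the chain, and the chain has
   l + 1 members. *)
Definition poly_chain C (l : nat) (f : 'I_l.+1 -> set 'cV[R]_k) : Prop :=
  [/\ forall i, face C (f i) /\ f i !=set0,
      forall i j : 'I_l.+1, (i < j)%N -> f i `<` f j,
      polyhedral (f ord0) &
      forall j, j != ord0 -> ~ polyhedral (f j)].

Definition ell_poly C : \bar R :=
  ereal_sup [set (l%:R)%:E | l in [set l | exists f, @poly_chain C l f]].

End Cones.

(* The problem (Q): sup <b, y> subject to g - B^* y \in C. *)
Record dual_problem (R : realType) (k m : nat) := DualProblem {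
  prob_cone : set 'cV[R]_k;
  prob_map : 'M[R]_(m, k);
  prob_rhs : 'cV[R]_m;
  prob_offset : 'cV[R]_k }.

Section FacialReduction.
Variables (R : realType) (k m : nat) (Q : dual_problem R k m).
Let C := prob_cone Q.
Let B := prob_map Q.
Let b := prob_rhs Q.
Let g := prob_offset Q.
Implicit Types (F G : set 'cV[R]_k) (d : 'cV[R]_k) (ds : seq 'cV[R]_k).

Definition slack (y : 'cV[R]_m) : 'cV[R]_k := g - B^T *m y.

Definition feasible_slacks : set 'cV[R]_k := [set slack y | y in setT] `&` C.

Definition theta_dual : \bar R :=
  ereal_sup [set (dot b y)%:E | y in [set y | C (slack y)]].

Definition minimal_face : set 'cV[R]_k := min_face C feasible_slacks.

Definition reducing_dir F d : Prop :=
  [/\ dual_cone F d, B *m d = 0, ~ orth F d & dot g d = 0].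

Definition infeasibility_dir F d : Prop :=
  [/\ dual_cone F d, B *m d = 0 & dot g d < 0].

(* [fr_steps ds F]: starting from the whole cone, the successive reducing
   directions [ds] lead to the face [F]. *)
Inductive fr_steps : seq 'cV[R]_k -> set 'cV[R]_k -> Prop :=
| fr_start : fr_steps [::] C
| fr_step ds F d : fr_steps ds F -> reducing_dir F d ->
    fr_steps (rcons ds d) (F `&` [set x | dot d x = 0]).

(* [fr_output ds F]: a complete run, with directions [ds] and final face [F].
   The members of [ds] are pairwise distinct (d_j vanishes on F_i for j < i,
   d_i does not), so [size ds] is the cardinality of the set of directions. *)
Inductive fr_output : seq 'cV[R]_k -> set 'cV[R]_k -> Prop :=
| fr_stop ds F : fr_steps ds F ->
    (forall d, ~ reducing_dir F d /\ ~ infeasibility_dir F d) -> fr_output ds F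
| fr_infeasible ds F d : fr_steps ds F -> infeasibility_dir F d ->
    fr_output (rcons ds d) set0.

(* Minima of sets of natural numbers are infima in [\bar R]; they are attained
   unless the set is empty, in which case the value is [+oo]. *)
Definition sing_degree : \bar R :=
  ereal_inf [set ((size ds)%:R)%:E | ds in [set ds | exists F, fr_output ds F]].

Definition primal_feasible F : set 'cV[R]_k :=
  [set x | B *m x = b /\ dual_cone F x].

Definition theta_primal F : \bar R :=
  ereal_inf [set (dot g x)%:E | x in primal_feasible F].

Definition primal_attained F : Prop :=
  exists2 x, primal_feasible F x & (dot g x)%:E = theta_primal F.

Definition strong_duality F : Prop :=
  theta_primal F = theta_dual /\
  ((-oo < theta_dual < +oo)%E -> primal_attained F).

(* Only directions with <g, d> = 0 yield a next face, hence [fr_steps] and not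
   [fr_output]. *)
Definition d_str : \bar R :=
  ereal_inf [set ((size ds)%:R)%:E |
               ds in [set ds | exists2 F, fr_steps ds F & strong_duality F]].

(* (Q) is infeasible, and so is the primal problem at every face that facial
   reduction can reach. Then the two values are -oo and +oo at all those faces:
   the minimum defining [d_str] is over the empty set. *)
Definition doubly_infeasible : Prop :=
  theta_dual = -oo%E /\ forall ds F, fr_steps ds F -> theta_primal F = +oo%E.

End FacialReduction.

Section Intersection.
Variables (R : realType) (n m : nat).
Variables (A : 'M[R]_(m, n)) (b : 'cV[R]_m) (c : 'cV[R]_n).

Definition prod_set (S1 S2 : set 'cV[R]_n) : set 'cV[R]_(n + n) :=
  [set x | S1 (usubmx x) /\ S2 (dsubmx x)].

Definition prob_inter (K1 K2 : set 'cV[R]_n) : dual_problem R n m :=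
  DualProblem (K1 `&` K2) A b c.

(* [row_mx A A *m col_mx x1 x2 = A *m x1 + A *m x2]. *)
Definition prob_dup (K1 K2 : set 'cV[R]_n) : dual_problem R (n + n) m :=
  DualProblem (prod_set K1 K2) (row_mx A A) b (col_mx c c).

End Intersection.

(* Main.v *)
Require Import Defs.
From HB Require Import structures.
From mathcomp Require Import all_boot all_order all_algebra.
From mathcomp Require Import all_classical all_reals all_analysis.
From mathcomp Require Import ring lra zify.
Set Implicit Arguments.
Unset Strict Implicit.
Unset Printing Implicit Defensive.
Import Order.TTheory GRing.Theory Num.Theory.
Import numFieldNormedType.Exports.
Local Open Scope classical_set_scope.
Local Open Scope ring_scope.

(* A direction (d1, d2) for the duplicated problem projects to d1 + d2, and the
   projected steps lead from K1 /\ K2 to F1 /\ F2 whenever the original ones lead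
   to F1 x F2; a step whose projection is orthogonal to the current face is
   skipped. This bounds the quantities of (D) by those of the duplicated problem.

   For the bounds by the distances to polyhedrality, reduce F1 x F2 as long as
   some d in W = (F1 x F2)^* with zero offset value and B d = 0 is not orthogonal
   to a nonpolyhedral factor. Each such step moves down a chain of nonpolyhedral
   faces, so at most ell_poly K1 + ell_poly K2 of them occur. Then let d be a
   relative interior point of W and G = (F1 x F2) /\ d^perp. By Farkas' lemma on
   the polyhedral factors, every v in G^* satisfies v + t d in (F1 x F2)^* for
   some t >= 0. Hence G admits no further direction unless F1 x F2 has an
   infeasibility direction, and primal solutions at G lift to F1 x F2 with the
   same value: one more step ends facial reduction, while strong duality holds
   already at F1 x F2. If the problem is infeasible, G lies in every reachable
   face, so a primal solution at any of them also lifts, and the infeasibility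
   direction drives its value to -oo.

   Separation is algebraic: a convex cone P (not assumed closed) which is not a
   subspace has an element of P^* that does not vanish identically on P. *)

(** * Bilinearity and definiteness of the inner product *)

Section Dot.
Variables (R : realType) (k : nat).
Implicit Types (u v w : 'cV[R]_k) (a : R).

Lemma dotE u v : dot u v = (u^T *m v) 0 0.
Proof. by rewrite mxE; apply: eq_bigr => i _; rewrite mxE. Qed.

Lemma dotC u v : dot u v = dot v u.
Proof. by apply: eq_bigr => i _; rewrite mulrC. Qed.

Lemma dotDr u v w : dot u (v + w) = dot u v + dot u w.
Proof. by rewrite !dotE mulmxDr mxE. Qed.

Lemma dotZr a u v : dot u (a *: v) = a * dot u v.
Proof. by rewrite !dotE -scalemxAr mxE. Qed.

Lemma dotDl u v w : dot (v + w) u = dot v u + dot w u.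
Proof. by rewrite !(dotC _ u) dotDr. Qed.

Lemma dotZl a u v : dot (a *: v) u = a * dot v u.
Proof. by rewrite !(dotC _ u) dotZr. Qed.

Lemma dotNr u v : dot u (- v) = - dot u v.
Proof. by rewrite -scaleN1r dotZr mulN1r. Qed.

Lemma dotNl u v : dot (- v) u = - dot v u.
Proof. by rewrite !(dotC _ u) dotNr. Qed.

Lemma dotBr u v w : dot u (v - w) = dot u v - dot u w.
Proof. by rewrite dotDr dotNr. Qed.

Lemma dotBl u v w : dot (v - w) u = dot v u - dot w u.
Proof. by rewrite dotDl dotNl. Qed.

Lemma dot0r u : dot u 0 = 0.
Proof. by rewrite -(scale0r 0) dotZr mul0r. Qed.

Lemma dot0l u : dot 0 u = 0.
Proof. by rewrite dotC dot0r. Qed.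

Lemma dot_sumr I (r : seq I) (P : pred I) u (f : I -> 'cV[R]_k) :
  dot u (\sum_(i <- r | P i) f i) = \sum_(i <- r | P i) dot u (f i).
Proof. by elim/big_rec2: _ => [|i y z _ <-]; rewrite ?dot0r ?dotDr. Qed.

Lemma dot_ge0 u : 0 <= dot u u.
Proof. by apply: sumr_ge0 => i _; rewrite -expr2 sqr_ge0. Qed.

Lemma dot_eq0 u : dot u u = 0 -> u = 0.
Proof.
move=> /eqP; rewrite psumr_eq0 => [/allP u0|i _]; last by rewrite -expr2 sqr_ge0.
apply/matrixP => i j; rewrite (ord1 j) mxE.
by have := u0 i; rewrite mem_index_enum /= mulf_eq0 orbb => /(_ isT)/eqP.
Qed.

Lemma dot_ge0_eq0 u : (forall v, 0 <= dot u v) -> u = 0.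
Proof.
move=> u_ge0; apply: dot_eq0; apply/eqP; rewrite eq_le dot_ge0 andbT.
by rewrite -oppr_ge0 -dotNr.
Qed.

End Dot.

Lemma dot_mulmxr (R : realType) k m (B : 'M[R]_(m, k)) u y :
  dot u (B^T *m y) = dot (B *m u) y.
Proof. by rewrite !dotE trmx_mul mulmxA. Qed.

Lemma dot_col_mx (R : realType) k l (u1 v1 : 'cV[R]_k) (u2 v2 : 'cV[R]_l) :
  dot (col_mx u1 u2) (col_mx v1 v2) = dot u1 v1 + dot u2 v2.
Proof. by rewrite !dotE tr_col_mx mul_row_col mxE. Qed.

(** * Convex cones, dual cones and spanning families *)

Section ConvexCones.
Variables (R : realType) (k : nat).
Implicit Types (u v w x y : 'cV[R]_k) (S P C F : set 'cV[R]_k).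

Lemma convex_cone0 P : convex_cone P -> P !=set0 -> P 0.
Proof.
by move=> cP [x Px]; have := cP x x 0 0 Px Px; rewrite !scale0r addr0; apply.
Qed.

Lemma convex_coneD P x y : convex_cone P -> P x -> P y -> P (x + y).
Proof.
by move=> cP Px Py; rewrite -[x]scale1r -[y]scale1r; apply: cP.
Qed.

Lemma convex_coneZ P x (t : R) : convex_cone P -> P x -> 0 <= t -> P (t *: x).
Proof.
by move=> cP Px t0; have := cP x x t 0 Px Px t0; rewrite scale0r addr0; apply.
Qed.

Lemma convex_cone_sum P (I : finType) (f : I -> 'cV[R]_k) :
  convex_cone P -> P 0 -> (forall i, P (f i)) -> P (\sum_i f i).
Proof.
move=> cP P0 Pf; apply: (big_ind P) => // x y; exact: convex_coneD.
Qed.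

Lemma convex_cone_dual S : convex_cone (dual_cone S).
Proof.
move=> x y s t Sx Sy s0 t0 z Sz.
by rewrite dotDl !dotZl addr_ge0// mulr_ge0// ?Sx ?Sy.
Qed.

Lemma dual_coneS S P : S `<=` P -> dual_cone P `<=` dual_cone S.
Proof. by move=> SP d dP x /SP; exact: dP. Qed.

Lemma convex_coneI P C : convex_cone P -> convex_cone C -> convex_cone (P `&` C).
Proof.
by move=> cP cC x y s t [Px Cx] [Py Cy] s0 t0; split; [exact: cP | exact: cC].
Qed.

(** Choose rows in [S] of maximal rank, which is at most [k]: a point of [S] outside their span
    could be appended and would raise the rank. *)
Lemma spanning_rows S : exists p (M : 'M[R]_(p, k)),
  (forall i, S (row i M)^T) /\ forall s, S s -> (s^T <= M)%MS.
Proof.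
pose Q r := exists p (M : 'M[R]_(p, k)), (forall i, S (row i M)^T) /\ \rank M = r.
have exQ : exists r, `[< Q r >].
  exists 0%N; apply/asboolP; exists 0%N, 0; split; first by case.
  by rewrite mxrank0.
have ubQ r : `[< Q r >] -> (r <= k)%N.
  by move=> /asboolP[p [M [_ <-]]]; exact: rank_leq_col.
case: (ex_maxnP exQ ubQ) => r /asboolP[p [M [SM rM]]] maxr.
exists p, M; split => // s Ss; apply: contrapT => /negP sM.
have : (r < \rank (col_mx M s^T))%N.
  rewrite -rM; apply: rank_ltmx.
  rewrite ltmxE; apply/andP; split.
    by rewrite -addsmxE addsmxSl.
  by apply: contra sM; apply: submx_trans; rewrite -addsmxE addsmxSr.
rewrite ltnNge maxr//; apply/asboolP; exists (p + 1)%N, (col_mx M s^T).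
split=> // i; rewrite -(splitK i); case: (fintype.split i) => j /=.
  by rewrite rowKu.
by rewrite rowKd [j]ord1 row_id trmxK.
Qed.

(* The sum of a spanning family of [S] behaves as a relative interior point. *)
Lemma spanning_order_unit p (M : 'M[R]_(p, k)) P v :
  convex_cone P -> P 0 -> (forall i, P (row i M)^T) -> (v^T <= M)%MS ->
  exists2 e : R, 0 < e & P (\sum_i (row i M)^T - e *: v).
Proof.
move=> cP P0 PM /submxP[a av].
have -> : v = \sum_i a 0 i *: (row i M)^T.
  rewrite -[v]trmxK av mulmx_sum_row linear_sum.
  by apply: eq_bigr => i _; rewrite linearZ.
(* Each row has coefficient [1 - e * a 0 i] in the difference, so [e * a 0 i <= 1] is needed; the
   summand 1 keeps the denominator positive when [a] vanishes. *)
pose e := (1 + \sum_i `|a 0 i|)^-1.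
have den_gt0 : 0 < 1 + \sum_i `|a 0 i| by rewrite ltr_pwDl// sumr_ge0.
exists e; first by rewrite invr_gt0.
rewrite scaler_sumr -sumrB; apply: convex_cone_sum => // i.
rewrite scalerA -[X in X - _]scale1r -scalerBl; apply: convex_coneZ => //.
rewrite subr_ge0 mulrC ler_pdivrMr// mul1r (le_trans (ler_norm _))//.
rewrite (bigD1 i)//= addrCA lerDl addr_ge0// sumr_ge0//.
Qed.

End ConvexCones.

(** * Separation of cones, Farkas' lemma, lineality spaces *)

Section Separation.
Variables (R : realType) (k : nat).
Implicit Types (u v w x y e d : 'cV[R]_k) (S P C F : set 'cV[R]_k).

(* Hahn-Banach step: [u] is an order unit in the directions [e] and [- e], and
   the value of the extension at [e] is the supremum in its definition. *)
Lemma extend_nonneg P (V : 'M[R]_k) d u e (r1 r2 : R) :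
  convex_cone P -> (u^T <= V)%MS ->
  0 < r1 -> P (u - r1 *: e) -> 0 < r2 -> P (u + r2 *: e) ->
  (forall v, P v -> (v^T <= V)%MS -> 0 <= dot d v) ->
  exists d', (forall v, (v^T <= V)%MS -> dot d' v = dot d v) /\
    (forall v, P v -> (v^T <= V + e^T)%MS -> 0 <= dot d' v).
Proof.
move=> cP uV r1_gt0 Pr1 r2_gt0 Pr2 d_ge0.
have [eV|/negP eV] := pselect (e^T <= V)%MS.
  exists d; split=> // v Pv vV; apply: d_ge0 => //.
  by apply: submx_trans vV _; rewrite addsmx_sub submx_refl.
have VD v1 v2 : (v1^T <= V)%MS -> (v2^T <= V)%MS -> ((v1 + v2)^T <= V)%MS.
  by move=> ? ?; rewrite linearD addmx_sub.
have VZ (r : R) v1 : (v1^T <= V)%MS -> ((r *: v1)^T <= V)%MS.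
  by move=> ?; rewrite linearZ scalemx_sub.
pose E := [set - dot d w | w in [set w | (w^T <= V)%MS /\ P (w + e)]].
have Eub w2 : (w2^T <= V)%MS -> P (w2 - e) -> ubound E (dot d w2).
  move=> w2V Pw2 _ [w1 [w1V Pw1] <-].
  have := d_ge0 (w1 + w2); rewrite dotDr => Pw12.
  rewrite -subr_ge0 opprK addrC; apply: Pw12; last exact: VD.
  have -> : w1 + w2 = (w1 + e) + (w2 - e).
    by rewrite addrACA subrr addr0.
  exact: convex_coneD.
have En0 : E !=set0.
  exists (- dot d (r2^-1 *: u)), (r2^-1 *: u) => //; split; first exact: VZ.
  have := convex_coneZ (t := r2^-1) cP Pr2.
  by rewrite scalerDr scalerA mulVf ?gt_eqF// scale1r; apply; rewrite invr_ge0 ltW.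
have Eub1 : has_ubound E.
  exists (dot d (r1^-1 *: u)); apply: Eub; first exact: VZ.
  have := convex_coneZ (t := r1^-1) cP Pr1.
  by rewrite scalerBr scalerA mulVf ?gt_eqF// scale1r; apply; rewrite invr_ge0 ltW.
(* A column of the cokernel of [V] vanishes on [V] but not at [e]; adding a multiple of it adjusts
   the value at [e] alone. *)
have [w [wV we]] : exists w, (forall v, (v^T <= V)%MS -> dot w v = 0) /\ dot w e != 0.
  have : e^T *m cokermx V != 0 by rewrite -submxE.
  case/matrix0Pn => i [j nz]; exists (col j (cokermx V)).
  have dotcol v : dot (col j (cokermx V)) v = (v^T *m cokermx V) 0 j.
    by rewrite dotC dotE !mxE; apply: eq_bigr => l _; rewrite !mxE.
  split=> [v|]; rewrite dotcol; last by rewrite (ord1 i) in nz.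
  by rewrite submxE => /eqP ->; rewrite mxE.
pose d' := d + ((sup E - dot d e) / dot w e) *: w.
have d'V v : (v^T <= V)%MS -> dot d' v = dot d v.
  by move=> vV; rewrite /d' dotDl dotZl (wV _ vV) mulr0 addr0.
have d'e : dot d' e = sup E.
  by rewrite /d' dotDl dotZl divfK// addrC subrK.
exists d'; split=> // v Pv /sub_addsmxP[[a c] /= va].
have [v1 [s [vE v1V]]] : exists v1 s, v = v1 + s *: e /\ (v1^T <= V)%MS.
  exists (a *m V)^T, (c 0 0); rewrite trmxK submxMl; split=> //.
  rewrite -[v]trmxK va linearD /=; congr (_ + _).
  by rewrite [c]mx11_scalar mul_scalar_mx linearZ /= trmxK mxE eqxx mulr1n.
rewrite vE dotDr dotZr d'V// d'e.
(* Rescaling [v] makes the coefficient of [e] equal to -1 or 1; then [sup E] being the least upper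
   bound, respectively an upper bound, gives the sign. *)
have [s_lt0|s_gt0|s0] := ltgtP s 0.
- have : P ((- s)^-1 *: v) by apply: convex_coneZ => //; rewrite invr_ge0; lra.
  rewrite vE scalerDr scalerA -[X in X^-1 * s]mulN1r invfM mulrAC -mulrA divff ?lt_eqF//.
  rewrite mulr1 invrN1 scaleN1r => Pv1.
  have := ge_sup En0 (Eub _ (VZ _ _ v1V) Pv1).
  rewrite dotZr => supE.
  have : - s * sup E <= - s * ((- s)^-1 * dot d v1) by rewrite ler_pM2l; lra.
  by rewrite mulrA divff; [lra|rewrite oppr_eq0 lt_eqF].
- have : P (s^-1 *: v) by apply: convex_coneZ => //; rewrite invr_ge0 ltW.
  rewrite vE scalerDr scalerA mulVf ?gt_eqF// scale1r => Pv1.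
  have : - dot d (s^-1 *: v1) <= sup E.
    by apply: ub_le_sup => //; exists (s^-1 *: v1) => //; split=> //; exact: VZ.
  rewrite dotZr -(ler_pM2l s_gt0) mulrN mulrA divff ?gt_eqF//; lra.
- by rewrite s0 mul0r addr0; apply: d_ge0 => //; rewrite vE s0 scale0r addr0 in Pv.
Qed.

(** The sum [u] of a spanning family of [P] is an order unit of its span. The functional with value
    1 at [u] is extended from the line of [u], one row at a time, staying nonnegative on [P]; its
    value at [u] shows that it is not orthogonal to [P]. *)
Lemma cone_separation P s : convex_cone P -> P s -> ~ P (- s) ->
  exists2 d, dual_cone P d & ~ orth P d.
Proof.
move=> cP Ps PNs.
have P0 : P 0 by apply: convex_cone0 => //; exists s.
have [p [M [PM MP]]] := spanning_rows P.
pose u := \sum_i (row i M)^T.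
have Pu : P u by exact: convex_cone_sum.
(* Some [u - e *: s] with [e > 0] lies in [P], so [- u] in [P] would put [- s] in [P]. *)
have PNu : ~ P (- u).
  move=> PNu; apply: PNs.
  have [e e0 Pe] := spanning_order_unit cP P0 PM (MP _ Ps).
  have := convex_coneD cP PNu Pe; rewrite addKr => Pes.
  have := convex_coneZ (t := e^-1) cP Pes.
  by rewrite scalerN scalerA mulVf ?gt_eqF// scale1r; apply; rewrite invr_ge0 ltW.
suff: forall n, exists (V : 'M[R]_k) d, [/\ (u^T <= V)%MS, dot d u = 1,
    (forall i : 'I_p, (i < n)%N -> (row i M <= V)%MS) &
    (forall v, P v -> (v^T <= V)%MS -> 0 <= dot d v)].
  move=> /(_ p)[V [d [uV du MV d_ge0]]]; exists d => [v Pv|/(_ _ Pu)].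
    apply: d_ge0 => //; apply: submx_trans (MP _ Pv) _.
    by apply/row_subP => i; exact: MV.
  by rewrite du => /eqP; rewrite oner_eq0.
elim=> [|n [V [d [uV du MV d_ge0]]]].
  have u_neq0 : u != 0 by apply/eqP => u0; apply: PNu; rewrite u0 oppr0 -u0.
  have uu_gt0 : 0 < dot u u.
    by rewrite lt_def dot_ge0 andbT; apply: contra_neq u_neq0 => /dot_eq0.
  exists <<u^T>>%MS, ((dot u u)^-1 *: u); split=> [|||v Pv].
  - by rewrite genmxE.
  - by rewrite dotZl mulVf ?gt_eqF.
  - by [].
  rewrite genmxE => /sub_rVP[c /(congr1 trmx)]; rewrite trmxK linearZ /= trmxK => vE.
  rewrite vE dotZl dotZr mulrCA mulVf ?gt_eqF// mulr1 leNgt; apply/negP => c_lt0.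
  apply: PNu; have -> : - u = (- c)^-1 *: v.
    by rewrite vE scalerA invrN mulNr mulVf ?lt_eqF// scaleN1r.
  by apply: convex_coneZ => //; rewrite invr_ge0; lra.
have [lt_np|le_pn] := ltnP n p; last first.
  by exists V, d; split=> // i _; apply: MV; exact: leq_trans le_pn.
pose e := (row (Ordinal lt_np) M)^T.
have eM : (e^T <= M)%MS by rewrite trmxK row_sub.
have [r1 r1_gt0 Pr1] := spanning_order_unit cP P0 PM eM.
have [r2 r2_gt0 Pr2] : exists2 r2, 0 < r2 & P (u + r2 *: e).
  have NeM : ((- e)^T <= M)%MS by rewrite linearN /= eqmx_opp.
  have [r2 r2_gt0] := spanning_order_unit cP P0 PM NeM.
  by rewrite scalerN opprK => ?; exists r2.
have [d' [d'V d'_ge0]] := extend_nonneg cP uV r1_gt0 Pr1 r2_gt0 Pr2 d_ge0.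
exists (V + e^T)%MS, d'; split=> //.
- exact: submx_trans uV (addsmxSl _ _).
- by rewrite d'V.
move=> i; rewrite ltnS leq_eqVlt => /orP[/eqP i_n|/MV iV].
  suff -> : row i M = e^T by exact: addsmxSr.
  by rewrite trmxK; congr (row _ M); exact: val_inj.
exact: submx_trans iV (addsmxSl _ _).
Qed.

(* Bartl's induction: a point violating the inequality for [z] lets one project
   the first generator out of all the others and of [z]. *)
Lemma farkas (s : seq 'cV[R]_k) z :
  (forall x, (forall a, a \in s -> 0 <= dot a x) -> 0 <= dot z x) ->
  exists2 l : nat -> R, (forall i, 0 <= l i) &
    z = \sum_(i < size s) l i *: s`_i.
Proof.
move: {2}(size s) (erefl (size s)) => n.
elim: n s z => [|n IH] [|a s] //= z sn z_ge0.
  exists (fun=> 0) => //; rewrite big_ord0; apply: dot_ge0_eq0 => x.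
  by apply: z_ge0.
case: sn => sn.
have [zs|] := pselect (forall x, (forall a, a \in s -> 0 <= dot a x) -> 0 <= dot z x).
  have [l l_ge0 zE] := IH _ _ sn zs.
  exists (fun i => if i is j.+1 then l j else 0); first by case.
  by rewrite big_ord_recl scale0r add0r.
move=> /existsNP[x0 /not_implyP[sx0 /negP]]; rewrite -ltNge => zx0.
have ax0 : dot a x0 < 0.
  rewrite ltNge; apply/negP => ax0; move: zx0; rewrite ltNge z_ge0// => b.
  by rewrite inE => /orP[/eqP ->|/sx0].
(* With the violating point scaled to value -1 at [a], [pr v] is orthogonal to [x1], and the
   transposed map sends every [x] into the hyperplane orthogonal to [a]. *)
pose x1 := (- (dot a x0)^-1) *: x0.
have ax1 : dot a x1 = -1 by rewrite dotZr mulNr mulVf ?lt_eqF.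
have sx1 b : b \in s -> 0 <= dot b x1.
  by move=> /sx0 ?; rewrite dotZr mulr_ge0// oppr_ge0 invr_le0 ltW.
have zx1 : dot z x1 < 0 by rewrite dotZr pmulr_rlt0// oppr_gt0 invr_lt0.
move: x1 ax1 sx1 zx1 => x1 ax1 sx1 zx1.
pose pr v := v + dot v x1 *: a.
have prE v x : dot (pr v) x = dot v (x + dot a x *: x1).
  by rewrite /pr dotDl dotZl dotDr dotZr [X in _ + X]mulrC.
have [||l l_ge0 zE] := IH [seq pr i | i <- s] (pr z).
- by rewrite size_map.
- move=> x prx; rewrite prE; apply: z_ge0 => b; rewrite inE => /orP[/eqP ->|bs].
    by rewrite dotDr dotZr ax1 mulrN1 subrr.
  by rewrite -prE prx// map_f.
rewrite size_map in zE.
(* Undoing the projections in [pr z] and in the generators collects this multiple of [a]. *)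
pose l0 := \sum_(i < size s) l i * dot s`_i x1 - dot z x1.
exists (fun i => if i is j.+1 then l j else l0) => [[|i]|] //.
  rewrite subr_ge0 (le_trans (ltW zx1))// sumr_ge0// => i _.
  by rewrite mulr_ge0// sx1// mem_nth.
rewrite big_ord_recl /= -[LHS](addrK (dot z x1 *: a)) -/(pr z) zE.
rewrite /l0 scalerBl [RHS]addrC addrA; congr (_ - _).
rewrite scaler_suml -big_split /=; apply: eq_bigr => i _.
by rewrite (nth_map 0)// scalerDr scalerA.
Qed.

(** As [d] is nonnegative on [F], the hyperplane section is cut out by the rows of [F] and the
    single inequality of [- d]. The Farkas multiplier of [- d] is the required [t]. *)
Lemma polyhedral_lift F d v : polyhedral F -> dual_cone F d ->
  dual_cone (F `&` [set x | dot d x = 0]) v ->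
  exists2 t : R, 0 <= t & dual_cone F (v + t *: d).
Proof.
move=> [p [N ->]] dF vF.
pose rows := [seq (row i N)^T | i <- enum 'I_p].
have dotrow i x : dot (row i N)^T x = (N *m x) i 0.
  by rewrite dotE trmxK -row_mul mxE.
have [|l l_ge0 vE] := @farkas (- d :: rows) v.
  move=> x x_ge0; apply: vF; have xN : forall i, 0 <= (N *m x) i 0.
    move=> i; rewrite -dotrow; apply: x_ge0; rewrite inE; apply/orP; right.
    by apply/mapP; exists i; rewrite ?mem_enum.
  split=> //=; apply/eqP; rewrite eq_le (dF x)// andbT -oppr_ge0 -dotNl.
  by rewrite x_ge0// mem_head.
exists (l 0%N) => // x xN; rewrite vE /= big_ord_recl /= scalerN addrAC addNr add0r.
rewrite dotC dot_sumr sumr_ge0// => i _; rewrite dotZr mulr_ge0//.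
have : rows`_i \in rows by rewrite mem_nth.
by case/mapP => j _ ->; rewrite dotC dotrow.
Qed.

(** The lineality space is a subspace, the kernel of a cokernel matrix, and each equation splits
    into two inequalities. It serves as the polyhedral bottom of chains of faces. *)
Lemma lineality_polyhedral P : convex_cone P -> P !=set0 ->
  polyhedral (P `&` [set x | P (- x)]).
Proof.
move=> cP /(convex_cone0 cP) P0; set L := _ `&` _.
have cL : convex_cone L.
  apply: convex_coneI => // x y s t Px Py s0 t0.
  by rewrite /= opprD -!scalerN; exact: cP.
have L0 : L 0 by split=> //=; rewrite oppr0.
have LN x : L x -> L (- x) by move=> [? ?]; split=> //=; rewrite opprK.
have [p [M [LM ML]]] := spanning_rows L.
have LE x : L x <-> (cokermx M)^T *m x = 0.
  split=> [/ML|/(congr1 trmx)/eqP].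
    by rewrite submxE => /eqP x0; apply: trmx_inj; rewrite trmx_mul trmxK x0 trmx0.
  rewrite trmx_mul trmxK trmx0 -submxE => /submxP[a xa].
  rewrite -[x]trmxK xa mulmx_sum_row linear_sum; apply: convex_cone_sum => // i.
  rewrite linearZ /=; have [?|?] := leP 0 (a 0 i); first exact: convex_coneZ.
  rewrite -[X in X *: _]opprK scaleNr -scalerN; apply: convex_coneZ => //.
    exact: LN.
  by rewrite oppr_ge0 ltW.
exists (k + k)%N, (col_mx (cokermx M)^T (- (cokermx M)^T)).
apply/seteqP; split=> x /=.
  by move=> /LE x0 i; rewrite mul_col_mx mulNmx x0 oppr0 col_mx0 mxE.
move=> x_ge0; apply/LE/matrixP => i j; rewrite (ord1 j) [RHS]mxE; apply/eqP.
have := x_ge0 (lshift _ i); have := x_ge0 (rshift _ i).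
by rewrite mul_col_mx col_mxEu col_mxEd mulNmx mxE oppr_ge0 eq_le => -> ->.
Qed.

End Separation.

(** * Slater points and primal attainment at irreducible faces *)

Section Reduction.
Variables (R : realType) (k m : nat) (Q : dual_problem R k m).
Local Notation C := (prob_cone Q).
Local Notation B := (prob_map Q).
Local Notation b := (prob_rhs Q).
Local Notation g := (prob_offset Q).
Implicit Types (F G : set 'cV[R]_k) (d v x e : 'cV[R]_k) (ds : seq 'cV[R]_k).

(** Unlike reducing directions, these may be orthogonal to [F], so that they form a convex cone
    containing 0. *)
Definition flat_dir F d : Prop := [/\ dual_cone F d, B *m d = 0 & dot g d = 0].

Definition irreducible F : Prop :=
  forall d, ~ reducing_dir Q F d /\ ~ infeasibility_dir Q F d.

Lemma convex_cone_hyperplane d : convex_cone [set x | dot d x = 0].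
Proof.
by move=> x y s t /= dx dy _ _; rewrite dotDr !dotZr dx dy !mulr0 addr0.
Qed.

Lemma dot_slack d y : B *m d = 0 -> dot d (slack Q y) = dot g d.
Proof. by move=> Bd; rewrite dotBr dot_mulmxr Bd dot0l subr0 dotC. Qed.

(** Let [P] be generated by [G], the range of [B^T] and [- g], and [u] be an order unit of [G]. If
    [- (u - g)] is in [P], some slack is a positive multiple of [u + v] with [v] in [G], again an
    order unit. Otherwise separation yields a direction that irreducibility forbids. *)
Lemma interior_slack G : convex_cone G -> G 0 -> irreducible G ->
  exists y, forall v, G v -> exists2 e : R, 0 < e & G (slack Q y - e *: v).
Proof.
move=> cG G0 irrG.
have [p [M [GM MG]]] := spanning_rows G.
pose u := \sum_i (row i M)^T.
have Gu : G u by exact: convex_cone_sum.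
pose P := [set x | exists v y (t : R), [/\ G v, 0 <= t & x = v + B^T *m y - t *: g]].
have cP : convex_cone P.
  move=> _ _ s1 s2 [v1 [y1 [t1 [Gv1 t10 ->]]]] [v2 [y2 [t2 [Gv2 t20 ->]]]] s10 s20.
  exists (s1 *: v1 + s2 *: v2), (s1 *: y1 + s2 *: y2), (s1 * t1 + s2 * t2).
  split; [exact: cG|by rewrite addr_ge0// mulr_ge0|].
  rewrite mulmxDr -!scalemxAr scalerDl -!scalerA !scalerBr !scalerDr opprD.
  by rewrite addrACA; congr (_ + _); rewrite addrACA.
have Pug : P (u - g).
  by exists u, 0, 1; split=> //; rewrite mulmx0 addr0 scale1r.
have [[v [y [t [Gv t0 uE]]]]|NP] := pselect (P (- (u - g))).
  have t1 : 0 < 1 + t by rewrite ltr_pwDl.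
  have slackE : slack Q ((1 + t)^-1 *: y) = (1 + t)^-1 *: (u + v).
    have -> : u + v = (1 + t) *: g - B^T *m y.
      have -> : v = - (u - g) + t *: g - B^T *m y by rewrite uE subrK addrK.
      by rewrite opprB scalerDl scale1r !addrA [u + g]addrC addrK.
    by rewrite scalerBr scalerA mulVf ?gt_eqF// scale1r scalemxAr.
  exists ((1 + t)^-1 *: y) => w Gw.
  have [e e0 Pe] := spanning_order_unit cG G0 GM (MG _ Gw).
  exists ((1 + t)^-1 * e); first by rewrite mulr_gt0// invr_gt0.
  rewrite slackE -scalerA -scalerBr; apply: convex_coneZ => //.
    by rewrite addrAC; exact: convex_coneD.
  by rewrite invr_ge0 ltW.
have [d dP NorthP] := cone_separation cP Pug NP.
have dG : dual_cone G d.
  move=> v Gv; apply: dP; exists v, 0, 0; split=> //.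
  by rewrite mulmx0 scale0r addr0 subr0.
have Bd : B *m d = 0.
  apply: dot_ge0_eq0 => y; rewrite -dot_mulmxr; apply: dP.
  by exists 0, y, 0; split=> //; rewrite scale0r add0r subr0.
have gd : dot g d <= 0.
  rewrite -oppr_ge0 dotC -dotNr; apply: dP; exists 0, 0, 1; split=> //.
  by rewrite mulmx0 addr0 add0r scale1r.
have [redG infG] := irrG d.
have gd0 : dot g d = 0.
  by apply/eqP; rewrite eq_le gd leNgt; apply/negP => gd_lt0; exact: infG.
have dG0 : orth G d by apply: contrapT => ?; exact: redG.
exfalso; apply: NorthP => _ [v [y [t [Gv _ ->]]]].
rewrite dotBr dotDr dot_mulmxr Bd dot0l dG0// dotZr [dot d g]dotC gd0.
by rewrite mulr0 subr0 addr0.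
Qed.

(** The cone is homogenised with a last coordinate for the objective. The vector [(0, -1)] is not in
    it, since [theta] bounds the objective, so a functional [(d, tau)] separates: [d / tau] is the
    primal point if [tau > 0], and [tau = 0] contradicts irreducibility. *)
Lemma slater_attained G y0 (theta : R) :
  convex_cone G -> G 0 -> irreducible G -> G (slack Q y0) ->
  (forall y, G (slack Q y) -> dot b y <= theta) ->
  exists2 x, primal_feasible Q G x & dot g x <= theta.
Proof.
move=> cG G0 irrG Gy0 le_theta.
pose P := [set z : 'cV[R]_(k + 1) | exists v y (t r : R), [/\ G v, 0 <= t, 0 <= r &
  z = col_mx (v + B^T *m y - t *: g) (const_mx (t * theta + r - dot b y))]].
have cP : convex_cone P.
  move=> _ _ s1 s2 [v1 [y1 [t1 [r1 [Gv1 t10 r10 ->]]]]]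
    [v2 [y2 [t2 [r2 [Gv2 t20 r20 ->]]]]] s10 s20.
  exists (s1 *: v1 + s2 *: v2), (s1 *: y1 + s2 *: y2).
  exists (s1 * t1 + s2 * t2), (s1 * r1 + s2 * r2).
  split; [exact: cG|by rewrite addr_ge0// mulr_ge0|by rewrite addr_ge0// mulr_ge0|].
  rewrite !scale_col_mx add_col_mx; congr col_mx.
    rewrite mulmxDr -!scalemxAr scalerDl -!scalerA !scalerBr !scalerDr opprD.
    by rewrite addrACA; congr (_ + _); rewrite addrACA.
  by apply/matrixP => i j; rewrite !mxE dotDr !dotZr; ring.
have dot1 (x : 'cV[R]_1) a : dot x (const_mx a) = x 0 0 * a.
  by rewrite /dot big_ord1 mxE.
have P1 : P (col_mx 0 (const_mx 1)).
  exists 0, 0, 0, 1; split=> //.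
  by rewrite mulmx0 scale0r addr0 subr0 dot0r mul0r add0r subr0.
have PN1 : ~ P (- col_mx 0 (const_mx 1)).
  move=> [v [y [t [r [Gv t0 r0]]]]].
  rewrite opp_col_mx => /eq_col_mx[vE /matrixP/(_ 0 0)]; rewrite !mxE => bE.
  have {}vE : v = t *: g - B^T *m y.
    by move/eqP: vE; rewrite oppr0 eq_sym subr_eq0 => /eqP <-; rewrite addrK.
  move: t0; rewrite le_eqVlt => /orP[/eqP t0|t_gt0].
    (* For [t = 0], [y] is a recession direction with [dot b y >= 1]; this step length already
       pushes the objective above [theta]. *)
    have := le_theta (y0 + (1 + `|theta - dot b y0|) *: y).
    rewrite -t0 scale0r sub0r in vE.
    have -> : slack Q (y0 + (1 + `|theta - dot b y0|) *: y) =
        slack Q y0 + (1 + `|theta - dot b y0|) *: v.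
      by rewrite vE /slack mulmxDr opprD addrA -scalemxAr scalerN.
    have n1 : 0 <= 1 + `|theta - dot b y0| by rewrite addr_ge0.
    move=> /(_ (convex_coneD cG Gy0 (convex_coneZ cG Gv n1))).
    rewrite dotDr dotZr => le1.
    have : (1 + `|theta - dot b y0|) * 1 <= (1 + `|theta - dot b y0|) * dot b y.
      by apply: ler_wpM2l => //; rewrite -t0 in bE; lra.
    have := ler_norm (theta - dot b y0); lra.
  (* For [t > 0], the objective at this point is [theta + (r + 1) / t]. *)
  have := le_theta (t^-1 *: y).
  have -> : slack Q (t^-1 *: y) = t^-1 *: v.
    by rewrite vE scalerBr scalerA mulVf ?gt_eqF// scale1r /slack scalemxAr.
  have tV : 0 <= t^-1 by rewrite invr_ge0 ltW.
  move=> /(_ (convex_coneZ cG Gv tV)).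
  rewrite dotZr -(ler_pM2l t_gt0) mulrA mulfV ?gt_eqF// mul1r; lra.
have [z zP NorthP] := cone_separation cP P1 PN1.
pose d := usubmx z; pose tau := dsubmx z 0 0.
have dotz v y t r :
    dot z (col_mx (v + B^T *m y - t *: g) (const_mx (t * theta + r - dot b y))) =
    dot d v + dot (B *m d) y - t * dot g d + tau * (t * theta + r - dot b y).
  by rewrite -[z]vsubmxK dot_col_mx dot1 dotBr dotDr dot_mulmxr dotZr [dot _ g]dotC.
have z_ge0 v y t r : G v -> 0 <= t -> 0 <= r ->
    0 <= dot d v + dot (B *m d) y - t * dot g d + tau * (t * theta + r - dot b y).
  by move=> Gv t0 r0; rewrite -dotz; apply: zP; exists v, y, t, r.
have dG : dual_cone G d.
  move=> v Gv; have := z_ge0 v 0 0 0 Gv (lexx _) (lexx _).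
  by rewrite !dot0r !mul0r !addr0 !subr0 mulr0 addr0.
have Bd : B *m d = tau *: b.
  apply/eqP; rewrite -subr_eq0; apply/eqP; apply: dot_ge0_eq0 => y.
  have := z_ge0 0 y 0 0 G0 (lexx _) (lexx _).
  by rewrite dot0r dotBl dotZl; lra.
have tau_ge0 : 0 <= tau.
  have := z_ge0 0 0 0 1 G0 (lexx _) ler01; rewrite !dot0r; lra.
have gd : dot g d <= tau * theta.
  have := z_ge0 0 0 1 0 G0 ler01 (lexx _); rewrite !dot0r; lra.
move: tau_ge0; rewrite le_eqVlt => /orP[/eqP tau0|tau_gt0].
  have [redG infG] := irrG d.
  rewrite -tau0 scale0r in Bd; rewrite -tau0 mul0r in gd.
  have gd0 : dot g d = 0.
    by apply/eqP; rewrite eq_le gd leNgt; apply/negP => gd_lt0; exact: infG.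
  have dG0 : orth G d by apply: contrapT => ?; exact: redG.
  exfalso; apply: NorthP => _ [v [y [t [r [Gv _ _ ->]]]]].
  by rewrite dotz Bd -tau0 dG0// gd0 dot0l mulr0 mul0r !addr0 subr0.
exists (tau^-1 *: d); first split.
- by rewrite -scalemxAr Bd scalerA mulVf ?gt_eqF// scale1r.
- by apply: convex_coneZ => //; [exact: convex_cone_dual|rewrite invr_ge0 ltW].
- by rewrite dotZr mulrC ler_pdivrMr// mulrC.
Qed.

End Reduction.

(** * Weak duality at the faces reached by facial reduction *)

Section ReachableFace.
Variables (R : realType) (k m : nat) (Q : dual_problem R k m).
Local Notation C := (prob_cone Q).
Local Notation B := (prob_map Q).
Local Notation b := (prob_rhs Q).
Local Notation g := (prob_offset Q).
Implicit Types (F G : set 'cV[R]_k) (d v x e : 'cV[R]_k) (ds : seq 'cV[R]_k).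

Hypotheses (cC : convex_cone C) (C0 : C 0).

Lemma fr_steps_cone ds F : fr_steps Q ds F -> convex_cone F /\ F 0.
Proof.
elim=> [|{}ds {}F d _ [cF F0] _]; first by [].
split; last by split=> //=; rewrite dot0r.
by apply: convex_coneI => //; exact: convex_cone_hyperplane.
Qed.

Lemma fr_steps_subset ds F : fr_steps Q ds F -> F `<=` C.
Proof. by elim=> // {}ds {}F d _ FC _ x [/FC]. Qed.

Lemma fr_steps_slack ds F y : fr_steps Q ds F -> C (slack Q y) -> F (slack Q y).
Proof.
move=> dsF Cy; elim: dsF => // {}ds {}F d _ Fy [_ Bd _ gd].
by split=> //=; rewrite dot_slack.
Qed.

Lemma weak_duality ds F x y : fr_steps Q ds F -> primal_feasible Q F x ->
  C (slack Q y) -> dot b y <= dot g x.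
Proof.
move=> dsF [Bx Fx] /(fr_steps_slack dsF)/Fx.
by rewrite dotBr dot_mulmxr Bx subr_ge0 [dot x g]dotC.
Qed.

Lemma theta_dual_le_primal ds F : fr_steps Q ds F -> (theta_dual Q <= theta_primal Q F)%E.
Proof.
move=> dsF; apply: ge_ereal_sup => _ [y Cy <-].
by apply: le_ereal_inf_tmp => _ [x Fx <-]; rewrite lee_fin; exact: weak_duality dsF Fx Cy.
Qed.

Lemma infeasibility_dir_slack ds F d y : fr_steps Q ds F ->
  infeasibility_dir Q F d -> ~ C (slack Q y).
Proof.
move=> dsF [Fd Bd gd] /(fr_steps_slack dsF)/Fd.
by rewrite dot_slack// leNgt gd.
Qed.

Lemma theta_dual_infeasible : (forall y, ~ C (slack Q y)) -> theta_dual Q = -oo%E.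
Proof.
move=> NC; rewrite /theta_dual (_ : [set _ | _ in _] = set0) ?ereal_sup0//.
by rewrite -subset0 => t [y /NC].
Qed.

(** * Faces [F] at which dual elements of [G] lift along [d] *)

Section LiftableFace.
Variables (ds : seq 'cV[R]_k) (F : set 'cV[R]_k) (d : 'cV[R]_k).
Local Notation G := (F `&` [set x | dot d x = 0]).
Hypotheses (dsF : fr_steps Q ds F) (dF : flat_dir Q F d).
Hypothesis lift : forall v, dual_cone G v ->
  exists2 t : R, 0 <= t & dual_cone F (v + t *: d).
Hypothesis flatG : forall v, flat_dir Q F v -> orth G v.

Let cG : convex_cone G.
Proof.
have [cF _] := fr_steps_cone dsF.
by apply: convex_coneI => //; exact: convex_cone_hyperplane.
Qed.

Let G0 : G 0.
Proof. by have [_ F0] := fr_steps_cone dsF; split=> //=; rewrite dot0r. Qed.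

(** Adding a multiple of [d] changes neither the image under [B] nor the value at [g], so a
    direction at [G] lifts to a flat or an infeasibility direction at [F]. *)
Lemma liftable_irreducible : (forall v, ~ infeasibility_dir Q F v) ->
  irreducible Q G.
Proof.
have [_ Bd gd] := dF; move=> Ninf v; split=> [[Gv Bv NGv gv]|[Gv Bv gv]].
  have [t t0 Fv] := lift Gv; apply: NGv => x Gx.
  have := flatG (v := v + t *: d) _ Gx; rewrite dotDl dotZl Gx.2 mulr0 addr0.
  apply; split=> //; first by rewrite mulmxDr -scalemxAr Bd scaler0 addr0.
  by rewrite dotDr dotZr gd mulr0 addr0.
have [t t0 Fv] := lift Gv; apply: (Ninf (v + t *: d)); split=> //.
  by rewrite mulmxDr -scalemxAr Bd scaler0 addr0.
by rewrite dotDr dotZr gd mulr0 addr0.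
Qed.

Lemma liftable_sing_degree : (sing_degree Q <= (size ds).+1%:R%:E)%E.
Proof.
have [[e eF]|Ninf] := pselect (exists e, infeasibility_dir Q F e).
  apply: ereal_inf_lbound; exists (rcons ds e); last by rewrite size_rcons.
  by exists set0; exact: fr_infeasible dsF eF.
have irrG : irreducible Q G.
  by apply: liftable_irreducible => e eF; apply: Ninf; exists e.
(* If [d] is orthogonal to [F] it is not a legal step, but then [G = F] and the run already stops at
   [F]. *)
have [dF0|NdF0] := pselect (orth F d).
  apply: (@le_trans _ _ (size ds)%:R%:E); last by rewrite lee_fin ler_nat.
  have FG : G = F by apply/seteqP; split=> [x []//|x Fx]; split=> //=; exact: dF0.
  rewrite FG in irrG.
  by apply: ereal_inf_lbound; exists ds => //; exists F; exact: fr_stop.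
apply: ereal_inf_lbound; exists (rcons ds d); last by rewrite size_rcons.
exists G; apply: fr_stop => //; apply: fr_step => //.
by have [? ? ?] := dF.
Qed.

(* A reducing direction of a larger face becomes flat at [F] after adding a
   multiple of [d], so it vanishes on [G]. *)
Lemma liftable_minimal ds' F' : fr_steps Q ds' F' -> G `<=` F'.
Proof.
have [_ Bd gd] := dF.
elim=> [x [/(fr_steps_subset dsF)]//|{}ds' {}F' d' _ GF' [F'd' Bd' _ gd'] x Gx].
split; first exact: GF'.
have [t t0 Fd'] := lift (dual_coneS GF' F'd').
have := flatG (v := d' + t *: d) _ Gx; rewrite dotDl dotZl Gx.2 mulr0 addr0.
apply; split=> //; first by rewrite mulmxDr -scalemxAr Bd scaler0 addr0.
by rewrite dotDr dotZr gd mulr0 addr0.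
Qed.

Lemma liftable_primal_feasible x : B *m x = b -> dual_cone G x ->
  exists2 z, primal_feasible Q F z & dot g z = dot g x.
Proof.
have [_ Bd gd] := dF => Bx Gx; have [t t0 Fx] := lift Gx.
exists (x + t *: d); last by rewrite dotDr dotZr gd mulr0 addr0.
by split=> //; rewrite mulmxDr -scalemxAr Bd scaler0 addr0.
Qed.

Lemma liftable_strong_duality : ~ doubly_infeasible Q -> strong_duality Q F.
Proof.
move=> Ndbl; have [[e eF]|Ninf] := pselect (exists e, infeasibility_dir Q F e).
  have NC y : ~ C (slack Q y) by exact: infeasibility_dir_slack dsF eF.
  rewrite /strong_duality (theta_dual_infeasible NC); split; last by rewrite ltxx.
  (* The dual value is [-oo], so the excluded double infeasibility provides a primal point at some
     reachable face. It restricts to [G] and lifts to [F]. *)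
  have [ds' [F' [dsF' [x [Bx F'x]]]]] : exists ds' F',
      fr_steps Q ds' F' /\ primal_feasible Q F' !=set0.
    apply: contrapT => NF'; apply: Ndbl; split=> [|ds' F' dsF']; first exact: theta_dual_infeasible.
    rewrite /theta_primal (_ : primal_feasible Q F' = set0).
      by rewrite image_set0 ereal_inf0.
    by rewrite -subset0 => x F'x; apply: NF'; exists ds', F'; split=> //; exists x.
  have [z [Bz Fz] _] :=
    liftable_primal_feasible Bx (dual_coneS (liftable_minimal dsF') F'x).
  have [Fe Be eg] := eF.
  suff le_r  r : (theta_primal Q F <= r%:E)%E.
    case: (theta_primal Q F) le_r => [a /(_ (a - 1)%R)|/(_ 0%R)|] //.
    by rewrite lee_fin lerBrDr gerDl ler10.
  apply: ge_ereal_inf.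
  (* Moving this far along the infeasibility direction brings the primal value down to at most [r];
     the maximum with 0 keeps the point in the dual cone. *)
  pose s := Num.max 0 ((dot g z - r) / - dot g e).
  have s0 : 0 <= s by rewrite le_max lexx.
  exists (dot g (z + s *: e))%:E.
    exists (z + s *: e) => //; split.
      by rewrite mulmxDr -scalemxAr Be scaler0 addr0.
    have cF := @convex_cone_dual _ _ F.
    exact: convex_coneD cF Fz (convex_coneZ cF Fe s0).
  rewrite lee_fin dotDr dotZr.
  have : (dot g z - r) / - dot g e <= s by rewrite le_max lexx orbT.
  by rewrite ler_pdivrMr ?oppr_gt0//; lra.
have irrG : irreducible Q G.
  by apply: liftable_irreducible => e eF; apply: Ninf; exists e.
have [y0 y0G] := interior_slack cG G0 irrG.
have Gy0 : G (slack Q y0).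
  by have [e _] := y0G _ G0; rewrite scaler0 subr0.
have GC : G `<=` C by move=> x [/(fr_steps_subset dsF)].
have le_theta y : C (slack Q y) -> ((dot b y)%:E <= theta_dual Q)%E.
  by move=> Cy; apply: ereal_sup_ubound; exists y.
have := theta_dual_le_primal dsF.
have := le_theta y0 (GC _ Gy0).
(* The Slater point [y0] rules out [-oo], and for [+oo] weak duality suffices. *)
rewrite /strong_duality; case thetaE : (theta_dual Q) => [theta| |] // _ wd;
  last first.
  by split; [apply/eqP; rewrite -leye_eq|rewrite ltxx andbF].
have [y Gy|x [Bx Gx] gx] := slater_attained (theta := theta) cG G0 irrG Gy0.
  by rewrite -lee_fin -thetaE; apply: le_theta; exact: GC.
have [z Fz gz] := liftable_primal_feasible Bx Gx.
have le_z : (theta_primal Q F <= (dot g z)%:E)%E by apply: ereal_inf_lbound; exists z.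
have z_le : ((dot g z)%:E <= theta%:E)%E by rewrite lee_fin gz.
have thetaP : theta_primal Q F = theta%:E.
  by apply/eqP; rewrite eq_le wd andbT (le_trans le_z).
split=> // _; exists z => //; apply/eqP.
by rewrite eq_le le_z andbT thetaP.
Qed.

End LiftableFace.
End ReachableFace.

(** * Faces, chains of nonpolyhedral faces, maximal flat directions *)

Lemma subset_proper_trans T (X Y Z : set T) : X `<=` Y -> Y `<` Z -> X `<` Z.
Proof.
move=> XY [YZ NZY]; split; first exact: subset_trans YZ.
by move=> ZX; apply: NZY; exact: subset_trans XY.
Qed.

Section Faces.
Variables (R : realType) (k : nat).
Implicit Types (d v x y : 'cV[R]_k) (C F G K : set 'cV[R]_k).

Lemma face_refl C : convex_cone C -> face C C.
Proof. by move=> cC; split. Qed.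

Lemma face_hyperplane C F d : face C F -> dual_cone F d ->
  face C (F `&` [set x | dot d x = 0]).
Proof.
move=> [FC cF fF] dF; split=> [x [/FC]//||x y Cx Cy [Fxy]] /=.
  by apply: convex_coneI => //; exact: convex_cone_hyperplane.
rewrite dotDr => /eqP; have [Fx Fy] := fF _ _ Cx Cy Fxy.
by rewrite paddr_eq0 ?dF// => /andP[/eqP dx /eqP dy].
Qed.

Lemma lineality_face K : convex_cone K -> face K (K `&` [set x | K (- x)]).
Proof.
move=> cK; split=> [x []//||x y Kx Ky [_ /= Nxy]].
  apply: convex_coneI => // x y s t Kx Ky s0 t0.
  by rewrite /= opprD -!scalerN; exact: cK.
split; split=> //=.
  by have := convex_coneD cK Nxy Ky; rewrite opprD subrK.
by have := convex_coneD cK Nxy Kx; rewrite opprD addrAC addNr add0r.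
Qed.

Lemma lineality_subset K F : face K F -> F 0 -> K `&` [set x | K (- x)] `<=` F.
Proof.
by move=> [_ _ fF] F0 x [Kx KNx]; have [] := fF _ _ Kx KNx; rewrite ?subrr.
Qed.

(** The chain is indexed downwards, in the order in which facial reduction meets its members, so
    that a new smallest face is appended at the end. *)
Definition nonpoly_chain_above K F (a : nat) : Prop :=
  exists f : nat -> set 'cV[R]_k,
    (forall i, (i < a)%N -> [/\ face K (f i), ~ polyhedral (f i) & F `<` f i]) /\
    (forall i j, (i < j < a)%N -> f j `<` f i).

Lemma nonpoly_chain_above0 K F : nonpoly_chain_above K F 0.
Proof. by exists (fun=> set0); split=> // i j; rewrite ltn0 andbF. Qed.

Lemma nonpoly_chain_aboveS K F G a : G `<=` F ->
  nonpoly_chain_above K F a -> nonpoly_chain_above K G a.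
Proof.
move=> GF [f [fK fF]]; exists f; split=> // i /fK[? ? Ffi]; split=> //.
exact: subset_proper_trans GF Ffi.
Qed.

Lemma nonpoly_chain_above_rcons K F G a : face K F -> ~ polyhedral F -> G `<` F ->
  nonpoly_chain_above K F a -> nonpoly_chain_above K G a.+1.
Proof.
move=> fF npF GF [f [fK ff]]; exists (fun i => if (i < a)%N then f i else F).
split=> [i|i j /andP[ij]]; rewrite ltnS leq_eqVlt => /orP[/eqP ia|ia].
- by rewrite ia ltnn.
- by have [? ? ?] := fK _ ia; rewrite ia; split=> //; exact: subset_proper_trans GF.1 _.
- by rewrite ia ltnn -ia ij; have [] := fK i; rewrite -?ia.
- by rewrite ia (ltn_trans ij ia); apply: ff; rewrite ij.
Qed.

(** The lineality space of [K] lies in every face containing 0, hence strictly below the chain. Put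
    at the bottom, it supplies the polyhedral member that the distance to polyhedrality does not
    count. *)
Lemma nonpoly_chain_le_ell_poly K F a : convex_cone K -> face K F -> F 0 ->
  nonpoly_chain_above K F a -> (a%:R%:E <= ell_poly K)%E.
Proof.
move=> cK fF F0 [f [fK ff]].
have K0 : K 0 by case: fF => + _ _; apply.
pose L := K `&` [set x | K (- x)].
have L0 : L 0 by split=> //=; rewrite oppr0.
have Lf i : (i < a)%N -> L `<` f i.
  move=> /fK[_ _]; exact: subset_proper_trans (lineality_subset fF F0).
apply: ereal_sup_ubound; exists a => //=.
(* The indices [1..a] are sent to [a - 1..0], which turns the descending chain into an ascending
   one. *)
exists (fun i : 'I_a.+1 => if i == ord0 then L else f (a - i)%N).
have subn_lt (i : 'I_a.+1) : i != ord0 -> (a - i < a)%N.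
  by rewrite -val_eqE /= => i0; have := ltn_ord i; lia.
split=> [i|i j ij||j j0].
- case: ifPn => [_|i0]; first by split; [exact: lineality_face|exists 0].
  have [? _ [/(_ _ F0) ? _]] := fK _ (subn_lt _ i0); split=> //.
  by exists 0.
- have j0 : j != ord0 by rewrite -val_eqE /=; lia.
  rewrite (negbTE j0); case: ifPn => [_|i0]; first exact/Lf/subn_lt.
  apply: ff; rewrite subn_lt// andbT; have := ltn_ord j; lia.
- by rewrite eqxx; apply: lineality_polyhedral => //; exists 0.
- by rewrite (negbTE j0); have [] := fK _ (subn_lt _ j0).
Qed.

Lemma ell_poly_ge0 K : convex_cone K -> K 0 -> (0 <= ell_poly K)%E.
Proof.
move=> cK K0; have := nonpoly_chain_above0 K K.
exact: nonpoly_chain_le_ell_poly (face_refl cK) K0.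
Qed.

(** A threshold rather than a single multiplier, so that one [t] can serve both factors of a
    product. *)
Lemma dual_cone_lift F d v : polyhedral F \/ orth F d -> dual_cone F d ->
  dual_cone (F `&` [set x | dot d x = 0]) v ->
  exists2 t0 : R, 0 <= t0 & forall t, t0 <= t -> dual_cone F (v + t *: d).
Proof.
move=> [pF|dF0] dF Gv.
  have [t0 t0_ge0 Fv] := polyhedral_lift pF dF Gv.
  exists t0 => // t le_t x Fx.
  have -> : v + t *: d = v + t0 *: d + (t - t0) *: d.
    by rewrite -addrA -scalerDl [t0 + _]addrC subrK.
  by rewrite dotDl addr_ge0 ?Fv// dotZl mulr_ge0 ?dF// subr_ge0.
exists 0 => // t _ x Fx; rewrite dotDl dotZl dF0// mulr0 addr0; apply: Gv.
by split=> //; exact: dF0.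
Qed.

(** Take the sum [d] of a spanning family of flat directions. For flat [v], some [d - e *: v] with
    [e > 0] is flat too, so [v] is nonpositive, hence zero, wherever [d] vanishes on [F]. *)
Lemma max_flat_dir m (Q : dual_problem R k m) F :
  exists2 d, flat_dir Q F d & forall v, flat_dir Q F v ->
    orth (F `&` [set x | dot d x = 0]) v.
Proof.
pose W := [set d | flat_dir Q F d].
have cW : convex_cone W.
  move=> x y s t [Fx Bx gx] [Fy By gy] s0 t0; split.
  - exact: convex_cone_dual.
  - by rewrite mulmxDr -!scalemxAr Bx By !scaler0 addr0.
  - by rewrite dotDr !dotZr gx gy !mulr0 addr0.
have W0 : W 0 by split=> [x _||]; rewrite ?dot0l ?mulmx0 ?dot0r.
have [p [M [WM MW]]] := spanning_rows W.
exists (\sum_i (row i M)^T); first exact: convex_cone_sum.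
move=> v Wv x [Fx /= dx].
have [e e0 [Fe _ _]] := spanning_order_unit cW W0 WM (MW _ Wv).
have := Fe _ Fx; rewrite dotBl dotZl dx sub0r oppr_ge0 pmulr_rle0// => vx.
by apply/eqP; rewrite eq_le vx; have [->] := Wv.
Qed.

End Faces.

(** * Faces and dual cones of products *)

Section ProductFaces.
Variables (R : realType) (n : nat).
Implicit Types (d x : 'cV[R]_(n + n)) (F K : set 'cV[R]_n).

Lemma dot_vsubmx d x :
  dot d x = dot (usubmx d) (usubmx x) + dot (dsubmx d) (dsubmx x).
Proof. by rewrite -dot_col_mx !vsubmxK. Qed.

Lemma prod_set_col F1 F2 (x1 x2 : 'cV[R]_n) :
  prod_set F1 F2 (col_mx x1 x2) = (F1 x1 /\ F2 x2).
Proof. by rewrite /prod_set /= col_mxKu col_mxKd. Qed.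

Lemma convex_cone_prod F1 F2 : convex_cone F1 -> convex_cone F2 ->
  convex_cone (prod_set F1 F2).
Proof.
move=> c1 c2 x y s t [x1 x2] [y1 y2] s0 t0; split.
  by rewrite linearD !linearZ; exact: c1.
by rewrite linearD !linearZ; exact: c2.
Qed.

Lemma face_prod K1 K2 F1 F2 : face K1 F1 -> face K2 F2 ->
  face (prod_set K1 K2) (prod_set F1 F2).
Proof.
move=> [FK1 c1 f1] [FK2 c2 f2]; split; first by move=> x [/FK1 ? /FK2].
  exact: convex_cone_prod.
move=> x y [x1 x2] [y1 y2] []; rewrite !linearD => xy1 xy2.
by have [? ?] := f1 _ _ x1 y1 xy1; have [? ?] := f2 _ _ x2 y2 xy2.
Qed.

Lemma dual_cone_prod F1 F2 d : F1 0 -> F2 0 ->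
  dual_cone (prod_set F1 F2) d <->
  dual_cone F1 (usubmx d) /\ dual_cone F2 (dsubmx d).
Proof.
move=> F10 F20; split=> [dF|[d1 d2] x [x1 x2]].
  split=> x Fx.
    have := dF (col_mx x 0); rewrite prod_set_col dot_vsubmx col_mxKu col_mxKd.
    by rewrite dot0r addr0; apply.
  have := dF (col_mx 0 x); rewrite prod_set_col dot_vsubmx col_mxKu col_mxKd.
  by rewrite dot0r add0r; apply.
by rewrite dot_vsubmx addr_ge0 ?d1 ?d2.
Qed.

Lemma orth_prod F1 F2 d : F1 0 -> F2 0 -> orth (prod_set F1 F2) d ->
  orth F1 (usubmx d) /\ orth F2 (dsubmx d).
Proof.
move=> F10 F20 dF; split=> x Fx.
  have := dF (col_mx x 0); rewrite prod_set_col dot_vsubmx col_mxKu col_mxKd.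
  by rewrite dot0r addr0; apply.
have := dF (col_mx 0 x); rewrite prod_set_col dot_vsubmx col_mxKu col_mxKd.
by rewrite dot0r add0r; apply.
Qed.

Lemma prod_set_hyperplane F1 F2 d :
  dual_cone F1 (usubmx d) -> dual_cone F2 (dsubmx d) ->
  prod_set F1 F2 `&` [set x | dot d x = 0] =
  prod_set (F1 `&` [set x | dot (usubmx d) x = 0])
           (F2 `&` [set x | dot (dsubmx d) x = 0]).
Proof.
move=> d1 d2; apply/seteqP; split=> x.
  move=> [[x1 x2] /=]; rewrite dot_vsubmx => /eqP.
  by rewrite paddr_eq0 ?d1 ?d2// => /andP[/eqP ? /eqP ?].
by move=> [[x1 /= e1] [x2 /= e2]]; split=> //=; rewrite dot_vsubmx e1 e2 addr0.
Qed.

End ProductFaces.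

(** * Minimal faces and their relative interior points *)

Section MinimalFace.
Variables (R : realType) (k : nat).
Implicit Types (x : 'cV[R]_k) (S C F : set 'cV[R]_k).

Lemma face_min_face C S : convex_cone C -> S `<=` C -> face C (min_face C S).
Proof.
move=> cC SC; split.
- by move=> x; apply; split=> //; exact: face_refl.
- move=> x y s t Sx Sy s0 t0 F FS; have [[_ cF _] _] := FS.
  by apply: cF => //; [exact: Sx | exact: Sy].
- move=> x y Cx Cy Sxy; split=> F FS; have [[_ _ fF] _] := FS;
    by have [] := fF _ _ Cx Cy (Sxy _ FS).
Qed.

Lemma min_faceS C S F : face C F -> S `<=` F -> min_face C S `<=` F.
Proof. by move=> fF SF x; apply. Qed.

Lemma sub_min_face C S : S `<=` min_face C S.
Proof. by move=> x Sx F [_]; apply. Qed.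

Lemma min_face_set0 C : min_face C set0 = set0.
Proof. by rewrite -subset0; apply: min_faceS; first by split. Qed.

Lemma convex_cone_shrink C s x (e e' : R) : convex_cone C -> C x -> e <= e' ->
  C (s - e' *: x) -> C (s - e *: x).
Proof.
move=> cC Cx le_e Ce.
have -> : s - e *: x = (s - e' *: x) + (e' - e) *: x by rewrite scalerBl addrA subrK.
by apply: convex_coneD => //; apply: convex_coneZ => //; rewrite subr_ge0.
Qed.

(* [s] stands for a relative interior point of [S], common to all cones [C]. *)
Lemma min_face_interior S : S !=set0 -> exists s,
  (forall F, convex_cone F -> S `<=` F -> F s) /\
  (forall C x, convex_cone C -> S `<=` C -> min_face C S x ->
     exists2 e : R, 0 < e & C (s - e *: x)).
Proof.
move=> [x0 Sx0]; have [p [M [SM MS]]] := spanning_rows S.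
have cone0 F : convex_cone F -> S `<=` F -> F 0.
  by move=> cF SF; apply: convex_cone0 => //; exists x0; exact: SF.
exists (\sum_i (row i M)^T); split=> [F cF SF|C x cC SC].
  by apply: convex_cone_sum => // [|i]; [exact: cone0|exact/SF/SM].
set s := \sum_i _; have C0 := cone0 _ cC SC.
have CM i : C (row i M)^T by exact/SC/SM.
have Cs : C s by exact: convex_cone_sum.
(* The points dominated by a multiple of [s] form a face containing [S], so the minimal face lies
   inside. *)
pose F := C `&` [set x | exists2 e : R, 0 < e & C (s - e *: x)].
suff fF : face C F.
  move=> /(_ F) [|_ //]; split=> // y Sy; split; first exact: SC.
  by apply: spanning_order_unit => //; exact: MS.
have FZ (a : R) y : F y -> 0 <= a -> F (a *: y).
  move=> [Cy [e e0 Ce]] a0; split; first exact: convex_coneZ.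
  have a1 : 0 < 1 + a by rewrite ltr_pwDl.
  exists (e / (1 + a)); first by rewrite divr_gt0.
  rewrite scalerA; apply: convex_cone_shrink Ce => //.
  by rewrite mulrAC ler_pdivrMr// ler_pM2l// lerDr.
have FD y z : F y -> F z -> F (y + z).
  move=> [Cy [e1 e10 Cey]] [Cz [e2 e20 Cez]]; split; first exact: convex_coneD.
  pose e := Num.min e1 e2.
  have e0 : 0 < e by rewrite lt_min e10.
  exists (2^-1 * e); first by rewrite mulr_gt0// invr_gt0.
  have -> : s - (2^-1 * e) *: (y + z) = 2^-1 *: (s - e *: y + (s - e *: z)).
    rewrite addrACA -opprD -scalerDr scalerBr -scalerA -mulr2n.
    by rewrite -[s *+ 2]scaler_nat [_ *: (_ *: s)]scalerA mulVf// scale1r.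
  apply: convex_coneZ => //; apply: convex_coneD => //.
    by apply: convex_cone_shrink Cey; rewrite // ge_min lexx.
  by apply: convex_cone_shrink Cez; rewrite // ge_min lexx orbT.
split=> [y []//|y z a b Fy Fz a0 b0|y z Cy Cz [_ [e e0 Ce]]].
  by apply: FD; exact: FZ.
split; split=> //; exists e => //.
  have -> : s - e *: y = (s - e *: (y + z)) + e *: z.
    by rewrite scalerDr opprD addrA subrK.
  by apply: convex_coneD => //; apply: convex_coneZ => //; exact: ltW.
have -> : s - e *: z = (s - e *: (y + z)) + e *: y.
  by rewrite scalerDr [e *: y + _]addrC opprD addrA subrK.
by apply: convex_coneD => //; apply: convex_coneZ => //; exact: ltW.
Qed.

End MinimalFace.

(** * Comparison of (D) with the duplicated problem *)

Section Duplication.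
Variables (R : realType) (n m : nat).
Variables (A : 'M[R]_(m, n)) (b : 'cV[R]_m) (c : 'cV[R]_n).
Variables (K1 K2 : set 'cV[R]_n).
Hypotheses (cK1 : convex_cone K1) (cK2 : convex_cone K2).
Hypotheses (K10 : K1 0) (K20 : K2 0).
Local Notation D := (prob_inter A b c K1 K2).
Local Notation Ddup := (prob_dup A b c K1 K2).
Implicit Types (F : set 'cV[R]_n) (d : 'cV[R]_(n + n)).

Lemma slack_dup y : slack Ddup y = col_mx (slack D y) (slack D y).
Proof.
by rewrite /slack /= tr_row_mx mul_col_mx opp_col_mx add_col_mx.
Qed.

Lemma theta_dual_dup : theta_dual Ddup = theta_dual D.
Proof.
rewrite /theta_dual; congr (ereal_sup [set _ | _ in _]).
by apply/seteqP; split=> y /=; rewrite slack_dup prod_set_col.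
Qed.

Lemma mul_row_dup d : row_mx A A *m d = A *m (usubmx d + dsubmx d).
Proof. by rewrite -{1}[d]vsubmxK mul_row_col mulmxDr. Qed.

Lemma dot_offset_dup d : dot (col_mx c c) d = dot c (usubmx d + dsubmx d).
Proof. by rewrite dot_vsubmx col_mxKu col_mxKd dotDr. Qed.

Let S := feasible_slacks D.
Let SK1 : S `<=` K1. Proof. by move=> x [_ []]. Qed.
Let SK2 : S `<=` K2. Proof. by move=> x [_ []]. Qed.

Lemma feasible_slacks_dup x :
  feasible_slacks Ddup x <-> exists2 s, S s & x = col_mx s s.
Proof.
split=> [[[y _ <-]]|[s [[y _ yE] [s1 s2]] ->]].
  rewrite slack_dup => -[]; rewrite col_mxKu col_mxKd => s1 s2.
  by exists (slack D y) => //; split=> //; exists y.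
by split; [exists y => //; rewrite slack_dup yE|split; rewrite ?col_mxKu ?col_mxKd].
Qed.

(** For the harder inclusion, a face containing the duplicated slacks contains [(s, s)] for an
    interior point [s]. Any [x] in the product satisfies [(s, s) - e *: x] in the cone for small
    [e > 0], and the face property captures [x]. *)
Lemma minimal_face_dup :
  minimal_face Ddup = prod_set (min_face K1 S) (min_face K2 S).
Proof.
have [[s0 Ss0]|S0] := pselect (S !=set0); last first.
  have -> : S = set0 by rewrite -subset0 => s Ss; apply: S0; exists s.
  rewrite !min_face_set0 /minimal_face.
  have -> : feasible_slacks Ddup = set0.
    by rewrite -subset0 => x /feasible_slacks_dup[s Ss _]; apply: S0; exists s.
  by rewrite min_face_set0; apply/seteqP; split=> x // [].
have cK := convex_cone_prod cK1 cK2.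
apply/seteqP; split.
  apply: min_faceS; first by apply: face_prod; exact: face_min_face.
  move=> x /feasible_slacks_dup[s Ss ->].
  by rewrite prod_set_col; split; exact: sub_min_face.
move=> x [x1 x2] F [[FK cF fF] SF].
have [|s [sF sC]] := @min_face_interior _ _ S; first by exists s0.
have Fss : F (col_mx s s).
  (* The preimage of [F] under the diagonal is a convex cone containing [S]. *)
  apply: (sF [set s | F (col_mx s s)]) => [u v a a' Fu Fv a0 a'0|u Su].
    by rewrite /= -add_col_mx -!scale_col_mx; exact: cF.
  by apply: SF; apply/feasible_slacks_dup; exists u.
have [e1 e10 Ke1] := sC _ _ cK1 SK1 x1.
have [e2 e20 Ke2] := sC _ _ cK2 SK2 x2.
have K1x : K1 (usubmx x) by have [+ _ _] := face_min_face cK1 SK1; exact.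
have K2x : K2 (dsubmx x) by have [+ _ _] := face_min_face cK2 SK2; exact.
pose e := Num.min e1 e2.
have e0 : 0 < e by rewrite lt_min e10.
have [_ Fex] : F (col_mx s s - e *: x) /\ F (e *: x).
  apply: fF; last by rewrite subrK.
    rewrite -[x]vsubmxK scale_col_mx opp_col_mx add_col_mx /= prod_set_col.
    split; [apply: convex_cone_shrink Ke1|apply: convex_cone_shrink Ke2] => //.
      by rewrite ge_min lexx.
    by rewrite ge_min lexx orbT.
  by apply: convex_coneZ => //; exact: ltW.
rewrite -[x]scale1r -(mulVf (lt0r_neq0 e0)) -scalerA.
by apply: convex_coneZ => //; rewrite invr_ge0 ltW.
Qed.

(** The same [s] is interior relative to both cones, so the smaller of the two step lengths works in
    their intersection. *)
Lemma minimal_face_inter : minimal_face D = min_face K1 S `&` min_face K2 S.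
Proof.
have cK : convex_cone (K1 `&` K2) by exact: convex_coneI.
have SK : S `<=` K1 `&` K2 by move=> s Ss; split; [exact: SK1|exact: SK2].
have [f1K c1 f1] := face_min_face cK1 SK1; have [f2K c2 f2] := face_min_face cK2 SK2.
apply/seteqP; split.
  apply: min_faceS; last by move=> s Ss; split; exact: sub_min_face.
  split=> [x [/f1K ? /f2K ?]//||x y [x1 x2] [y1 y2] [xy1 xy2]].
    exact: convex_coneI.
  by have [? ?] := f1 _ _ x1 y1 xy1; have [? ?] := f2 _ _ x2 y2 xy2.
have [[s0 Ss0]|S0] := pselect (S !=set0); last first.
  have -> : S = set0 by rewrite -subset0 => s Ss; apply: S0; exists s.
  by rewrite !min_face_set0 => x [].
move=> x [x1 x2] F [[FK cF fF] SF].
have [|s [sF sC]] := @min_face_interior _ _ S; first by exists s0.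
have [e1 e10 Ke1] := sC _ _ cK1 SK1 x1.
have [e2 e20 Ke2] := sC _ _ cK2 SK2 x2.
pose e := Num.min e1 e2.
have e0 : 0 < e by rewrite lt_min e10.
have Kx : (K1 `&` K2) x by split; [exact: f1K|exact: f2K].
have [_ Fex] : F (s - e *: x) /\ F (e *: x).
  apply: fF; last by rewrite subrK; exact: sF.
    split; [apply: convex_cone_shrink Ke1|apply: convex_cone_shrink Ke2] => //.
    - exact: f1K.
    - by rewrite ge_min lexx.
    - exact: f2K.
    - by rewrite ge_min lexx orbT.
  by apply: convex_coneZ => //; exact: ltW.
rewrite -[x]scale1r -(mulVf (lt0r_neq0 e0)) -scalerA.
by apply: convex_coneZ => //; rewrite invr_ge0 ltW.
Qed.

Lemma dual_cone_add F1 F2 d : dual_cone F1 (usubmx d) -> dual_cone F2 (dsubmx d) ->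
  dual_cone (F1 `&` F2) (usubmx d + dsubmx d).
Proof. by move=> d1 d2 x [x1 x2]; rewrite dotDl addr_ge0 ?d1 ?d2. Qed.

Lemma convex_cone_Ddup : convex_cone (prob_cone Ddup).
Proof. exact: convex_cone_prod. Qed.

Lemma Ddup_cone0 : prob_cone Ddup 0.
Proof. by split; rewrite linear0. Qed.

Lemma fr_steps_dup ds (F : set 'cV[R]_(n + n)) : fr_steps Ddup ds F -> exists F1 F2 ds',
  [/\ F = prod_set F1 F2, F1 0, F2 0, (size ds' <= size ds)%N &
      fr_steps D ds' (F1 `&` F2)].
Proof.
elim=> [|{}ds {}F d _ [F1 [F2 [ds' [-> F10 F20 le_ds ds'F]]]] [Fd Bd NFd gd]].
  by exists K1, K2, [::]; split=> //; exact: fr_start.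
have [d1 d2] := (dual_cone_prod d F10 F20).1 Fd.
rewrite prod_set_hyperplane//.
set G1 := F1 `&` _; set G2 := F2 `&` _.
have GE : G1 `&` G2 = (F1 `&` F2) `&` [set x | dot (usubmx d + dsubmx d) x = 0].
  apply/seteqP; split=> x.
    by move=> [[x1 /= e1] [x2 /= e2]]; split=> //=; rewrite dotDl e1 e2 addr0.
  move=> [[x1 x2] /=]; rewrite dotDl => /eqP.
  by rewrite paddr_eq0 ?d1 ?d2// => /andP[/eqP ? /eqP ?].
have G10 : G1 0 by split=> //=; rewrite dot0r.
have G20 : G2 0 by split=> //=; rewrite dot0r.
have [oF|NoF] := pselect (orth (F1 `&` F2) (usubmx d + dsubmx d)).
  exists G1, G2, ds'; split=> //; first by rewrite size_rcons leqW.
  suff -> : G1 `&` G2 = F1 `&` F2 by [].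
  by rewrite GE; apply/seteqP; split=> [x []//|x Fx]; split=> //=; exact: oF.
exists G1, G2, (rcons ds' (usubmx d + dsubmx d)); split=> //.
  by rewrite !size_rcons.
rewrite GE; apply: fr_step => //; split=> //; first exact: dual_cone_add.
  by rewrite -mul_row_dup.
by rewrite -dot_offset_dup.
Qed.

(** A dual element of an intersection need not split into a sum of dual elements, so directions are
    not pulled back. Instead an interior slack [(s, s)] of the product is used: a direction with
    nonpositive offset value vanishes at [s], hence on all of [F1 /\ F2]. *)
Lemma irreducible_dup F1 F2 : convex_cone (prod_set F1 F2) -> F1 0 -> F2 0 ->
  irreducible Ddup (prod_set F1 F2) -> irreducible D (F1 `&` F2).
Proof.
move=> cF F10 F20 irrF.
have F0 : prod_set F1 F2 0 by split; rewrite linear0.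
have [y intF] := interior_slack cF F0 irrF.
have Fy : (F1 `&` F2) (slack D y).
  have [e _] := intF _ F0.
  by rewrite scaler0 subr0 slack_dup prod_set_col.
have flat (d : 'cV[R]_n) : dual_cone (F1 `&` F2) d -> A *m d = 0 -> dot c d <= 0 ->
    dot c d = 0 /\ orth (F1 `&` F2) d.
  move=> Fd Ad cd; have dy := dot_slack (Q := D) y Ad.
  have cd0 : dot c d = 0 by apply/eqP; rewrite eq_le cd -dy; exact: Fd.
  split=> // x Fx; apply/eqP; rewrite eq_le Fd// andbT.
  have [|e e0] := intF (col_mx x x); first by rewrite prod_set_col.
  rewrite slack_dup scale_col_mx opp_col_mx add_col_mx prod_set_col => /Fd.
  by rewrite dotBr dy cd0 sub0r dotZr oppr_ge0 pmulr_rle0.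
move=> d; split=> [[Fd Ad NFd cd]|[Fd Ad cd]].
  by apply: NFd; apply: (flat _ Fd Ad _).2; rewrite cd.
by have [cd0 _] := flat _ Fd Ad (ltW cd); rewrite cd0 ltxx in cd.
Qed.

Lemma sing_degree_dup : (sing_degree D <= sing_degree Ddup)%E.
Proof.
apply: le_ereal_inf_tmp => _ [ds [F dsF] <-]; apply: ge_ereal_inf.
case: dsF => {}ds {}F => [dsF irrF|d dsF [Fd Bd gd]].
  have [cF _] := fr_steps_cone convex_cone_Ddup Ddup_cone0 dsF.
  have [F1 [F2 [ds' [FE F10 F20 le_ds ds'F]]]] := fr_steps_dup dsF.
  exists (size ds')%:R%:E; last by rewrite lee_fin ler_nat.
  exists ds' => //; exists (F1 `&` F2); apply: fr_stop => //.
  by apply: irreducible_dup; rewrite -?FE.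
have [F1 [F2 [ds' [FE F10 F20 le_ds ds'F]]]] := fr_steps_dup dsF.
rewrite FE in Fd; have [d1 d2] := (dual_cone_prod d F10 F20).1 Fd.
exists (size (rcons ds' (usubmx d + dsubmx d)))%:R%:E.
  exists (rcons ds' (usubmx d + dsubmx d)) => //; exists set0.
  apply: (fr_infeasible ds'F); split; first exact: dual_cone_add.
    by rewrite -mul_row_dup.
  by rewrite -dot_offset_dup.
by rewrite lee_fin ler_nat !size_rcons.
Qed.

(** Adding the two blocks of a primal point keeps feasibility and value, which bounds the primal
    value of (D) by the common dual value; weak duality gives the reverse, and attainment projects
    too. *)
Lemma d_str_dup : (d_str D <= d_str Ddup)%E.
Proof.
apply: le_ereal_inf_tmp => _ [ds [F dsF [thetaE att]] <-]; apply: ge_ereal_inf.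
have [F1 [F2 [ds' [FE F10 F20 le_ds ds'F]]]] := fr_steps_dup dsF.
exists (size ds')%:R%:E; last by rewrite lee_fin ler_nat.
exists ds' => //; exists (F1 `&` F2) => //.
have proj z : primal_feasible Ddup F z ->
    primal_feasible D (F1 `&` F2) (usubmx z + dsubmx z).
  move=> [Bz]; rewrite FE => /(dual_cone_prod z F10 F20)[z1 z2].
  by split; [rewrite -Bz -mul_row_dup|exact: dual_cone_add].
have le_P : (theta_primal D (F1 `&` F2) <= theta_primal Ddup F)%E.
  apply: le_ereal_inf_tmp => _ [z Fz <-]; apply: ereal_inf_lbound.
  by exists (usubmx z + dsubmx z); [exact: proj|rewrite -dot_offset_dup].
have thetaDE : theta_primal D (F1 `&` F2) = theta_dual D.
  apply/eqP; rewrite eq_le (theta_dual_le_primal ds'F) andbT.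
  by rewrite -theta_dual_dup -thetaE.
split=> // theta_fin; have [|z Fz zE] := att; first by rewrite theta_dual_dup.
exists (usubmx z + dsubmx z); first exact: proj.
by rewrite thetaDE -theta_dual_dup -thetaE -zE -dot_offset_dup.
Qed.

Definition saturated F1 F2 : Prop := forall d, flat_dir Ddup (prod_set F1 F2) d ->
  (polyhedral F1 \/ orth F1 (usubmx d)) /\ (polyhedral F2 \/ orth F2 (dsubmx d)).

Lemma saturated_liftable F1 F2 : F1 0 -> F2 0 -> saturated F1 F2 ->
  let F := prod_set F1 F2 in exists d, let G := F `&` [set x | dot d x = 0] in
  [/\ flat_dir Ddup F d,
      forall v, dual_cone G v -> exists2 t : R, 0 <= t & dual_cone F (v + t *: d) &
      forall v, flat_dir Ddup F v -> orth G v].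
Proof.
move=> F10 F20 satF F; have [d dF orthG] := max_flat_dir Ddup F.
exists d; split=> // v.
have [s1 s2] := satF _ dF; have [Fd _ _] := dF.
have [d1 d2] := (dual_cone_prod d F10 F20).1 Fd.
rewrite prod_set_hyperplane// => Gv.
have [||v1 v2] := (dual_cone_prod v _ _).1 Gv.
- by split=> //=; rewrite dot0r.
- by split=> //=; rewrite dot0r.
have [t1 t10 lift1] := dual_cone_lift s1 d1 v1.
have [t2 t20 lift2] := dual_cone_lift s2 d2 v2.
exists (t1 + t2); first by rewrite addr_ge0.
apply/dual_cone_prod => //; rewrite !linearD !linearZ.
by split; [apply: lift1; rewrite lerDl|apply: lift2; rewrite lerDr].
Qed.

(* Each step shrinks a nonpolyhedral factor, which uses up one element of a
   chain counted by the distance to polyhedrality. *)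
Lemma saturate_steps N :
  (exists ds F1 F2, [/\ fr_steps Ddup ds (prod_set F1 F2), F1 0, F2 0,
     saturated F1 F2 & ((size ds)%:R%:E <= ell_poly K1 + ell_poly K2)%E]) \/
  (N%:R%:E <= ell_poly K1 + ell_poly K2)%E.
Proof.
pose reach ds F1 F2 a1 a2 := [/\ fr_steps Ddup ds (prod_set F1 F2),
  face K1 F1 /\ F1 0, face K2 F2 /\ F2 0,
  nonpoly_chain_above K1 F1 a1 /\ nonpoly_chain_above K2 F2 a2 &
  (size ds <= a1 + a2)%N].
have reach_le ds F1 F2 a1 a2 l : reach ds F1 F2 a1 a2 -> (l <= size ds)%N ->
    (l%:R%:E <= ell_poly K1 + ell_poly K2)%E.
  move=> [_ [f1 F10] [f2 F20] [c1 c2] le_ds] le_l.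
  apply: (@le_trans _ _ (a1%:R%:E + a2%:R%:E)%E).
    by rewrite -EFinD -natrD lee_fin ler_nat (leq_trans le_l).
  apply: leeD; first exact: nonpoly_chain_le_ell_poly c1.
  exact: nonpoly_chain_le_ell_poly c2.
suff: (exists ds F1 F2 a1 a2, reach ds F1 F2 a1 a2 /\ saturated F1 F2) \/
    (exists ds F1 F2 a1 a2, reach ds F1 F2 a1 a2 /\ (N <= size ds)%N).
  move=> [[ds [F1 [F2 [a1 [a2 [dsF satF]]]]]]|[ds [F1 [F2 [a1 [a2 [dsF le_N]]]]]]].
    left; exists ds, F1, F2; have := dsF => -[? [_ ?] [_ ?] _ _]; split=> //.
    exact: reach_le dsF _.
  by right; exact: reach_le dsF le_N.
elim: N => [|N [IH|[ds [F1 [F2 [a1 [a2 [dsF le_N]]]]]]]].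
- right; exists [::], K1, K2, 0, 0; split=> //; split=> //.
  + exact: fr_start.
  + by split=> //; exact: face_refl.
  + by split=> //; exact: face_refl.
  + by split; exact: nonpoly_chain_above0.
- by left.
have [satF|] := pselect (saturated F1 F2).
  by left; exists ds, F1, F2, a1, a2.
move=> /existsNP[d /not_implyP[[Fd Bd gd] NsatF]]; right.
have [dsF' [f1 F10] [f2 F20] [c1 c2] le_ds] := dsF.
have [d1 d2] := (dual_cone_prod d F10 F20).1 Fd.
pose G1 := F1 `&` [set x | dot (usubmx d) x = 0].
pose G2 := F2 `&` [set x | dot (dsubmx d) x = 0].
have GF1 : G1 `<=` F1 by move=> x [].
have GF2 : G2 `<=` F2 by move=> x [].
suff [a1' [a2' [c1' c2' lt_a NF]]] : exists a1' a2',
    [/\ nonpoly_chain_above K1 G1 a1', nonpoly_chain_above K2 G2 a2',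
      (a1 + a2 < a1' + a2')%N & ~ orth (prod_set F1 F2) d].
  exists (rcons ds d), G1, G2, a1', a2'; split; last by rewrite size_rcons ltnS.
  split=> //; last by rewrite size_rcons (leq_ltn_trans le_ds).
  - by rewrite -prod_set_hyperplane//; exact: fr_step.
  - by split; [exact: face_hyperplane|split=> //=; rewrite dot0r].
  - by split; [exact: face_hyperplane|split=> //=; rewrite dot0r].
have proper F e : dual_cone F e -> ~ orth F e -> F `&` [set x | dot e x = 0] `<` F.
  move=> Fe NFe; split=> [x []//|FG]; apply: NFe => x /FG[]//.
move: NsatF => /not_andP[/not_orP[np1 o1]|/not_orP[np2 o2]].
  exists a1.+1, a2; split=> //; last by move=> /(orth_prod F10 F20)[].
    by apply: nonpoly_chain_above_rcons c1 => //; exact: proper.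
  exact: nonpoly_chain_aboveS c2.
exists a1, a2.+1; split=> //; last by move=> /(orth_prod F10 F20)[].
- exact: nonpoly_chain_aboveS c1.
- by apply: nonpoly_chain_above_rcons c2 => //; exact: proper.
- by rewrite addnS.
Qed.

(** Taking [N] above the finite sum of distances rules out the second alternative of
    [saturate_steps]. *)
Lemma saturated_face : (ell_poly K1 + ell_poly K2 < +oo)%E ->
  exists ds F1 F2, [/\ fr_steps Ddup ds (prod_set F1 F2), F1 0, F2 0,
     saturated F1 F2 & ((size ds)%:R%:E <= ell_poly K1 + ell_poly K2)%E].
Proof.
have l1 := ell_poly_ge0 cK1 K10; have l2 := ell_poly_ge0 cK2 K20.
have := adde_ge0 l1 l2; case lE : (ell_poly K1 + ell_poly K2)%E => [r| |] // r0 _.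
have [//|] := saturate_steps (Num.bound r); rewrite lE//.
rewrite lee_fin leNgt; rewrite lee_fin in r0.
by have := archi_boundP r0 => ->.
Qed.

End Duplication.

Theorem theorem19 (R : realType) (n m : nat)
    (A : 'M[R]_(m, n)) (b : 'cV[R]_m) (c : 'cV[R]_n)
    (K1 K2 : set 'cV[R]_n)
    (hK1 : closed_convex_cone K1) (hK2 : closed_convex_cone K2) :
  let D := prob_inter A b c K1 K2 in
  let Ddup := prob_dup A b c K1 K2 in
  [/\ (exists F1 F2, [/\ face K1 F1, face K2 F2 &
                         minimal_face Ddup = prod_set F1 F2]) /\
      (forall F1 F2, minimal_face Ddup = prod_set F1 F2 ->
                     minimal_face D = F1 `&` F2),
      (sing_degree D <= sing_degree Ddup)%E,
      (sing_degree Ddup <= 1 + ell_poly K1 + ell_poly K2)%E,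
      (d_str D <= d_str Ddup)%E &
      ~ doubly_infeasible Ddup -> (d_str Ddup <= ell_poly K1 + ell_poly K2)%E].
Proof.
move=> D Ddup; have [K1n0 _ cK1] := hK1; have [K2n0 _ cK2] := hK2.
have K10 := convex_cone0 cK1 K1n0; have K20 := convex_cone0 cK2 K2n0.
have SK1 : feasible_slacks D `<=` K1 by move=> x [_ []].
have SK2 : feasible_slacks D `<=` K2 by move=> x [_ []].
have minDup := minimal_face_dup A b c cK1 cK2.
have cC := convex_cone_Ddup (A := A) (b := b) (c := c) cK1 cK2.
have C0 := Ddup_cone0 A b c K10 K20.
split.
- split.
    exists (min_face K1 (feasible_slacks D)), (min_face K2 (feasible_slacks D)).
    by split=> //; exact: face_min_face.
  move=> F1 F2 prodE; rewrite [minimal_face D](minimal_face_inter A b c cK1 cK2).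
  have {prodE} : prod_set _ _ = prod_set F1 F2 := etrans (esym minDup) prodE.
  (* An empty product does not determine its factors, so the intersections are compared through
     diagonal points [(x, x)]. *)
  move=> /seteqP[sub1 sub2]; apply/seteqP; split=> x [x1 x2].
    by have := sub1 (col_mx x x); rewrite !prod_set_col; apply.
  by have := sub2 (col_mx x x); rewrite !prod_set_col; apply.
- exact: sing_degree_dup.
- rewrite -addeA; have [->|ell_fin] := eqVneq (ell_poly K1 + ell_poly K2)%E +oo%E.
    by rewrite addey// leey.
  have [|ds [F1 [F2 [dsF F10 F20 satF le_ds]]]] :=
    saturated_face A b c cK1 cK2 K10 K20; first by rewrite ltey.
  have [d [dF lift orthG]] := saturated_liftable F10 F20 satF.
  apply: le_trans (liftable_sing_degree dsF dF lift orthG) _.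
  by rewrite -addn1 addnC natrD EFinD leeD2l.
- exact: d_str_dup.
move=> Ndbl; have [->|ell_fin] := eqVneq (ell_poly K1 + ell_poly K2)%E +oo%E.
  by rewrite leey.
have [|ds [F1 [F2 [dsF F10 F20 satF le_ds]]]] :=
  saturated_face A b c cK1 cK2 K10 K20; first by rewrite ltey.
have [d [dF lift orthG]] := saturated_liftable F10 F20 satF.
apply: ge_ereal_inf; exists (size ds)%:R%:E => //; exists ds => //.
exists (prod_set F1 F2) => //.
exact (liftable_strong_duality cC C0 dsF dF lift orthG Ndbl).
Qed.
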